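(* Let $f$ be a conformal map of $\mathbb{D}=\{z\in\mathbb{C}:|z|<1\}$ onto a domain $\Omega:=f(\mathbb{D})$. Suppose that $$\Lambda_{\mathrm{sph}}(f):=\sup_{0<r<1}\int_{\partial\mathbb{D}_r}\frac{|f'(z)|}{1+|f(z)|^2}\,|dz|<\infty,$$ where $\mathbb{D}_r=\{z\in\mathbb{C}:|z|<r\}$. Then $\partial\Omega$ is locally connected.
   Context: A conformal map of $\mathbb{D}$ onto a plane domain $\Omega\subset\mathbb{C}$ means an injective holomorphic function on $\mathbb{D}$ with image $\Omega$. The boundary $\partial\Omega$ is taken in the Riemann sphere $\widehat{\mathbb{C}}$, with the topology of the spherical metric. *)

(* Defs.v *)
From HB Require Import structures.
From mathcomp Require Import all_boot all_order all_algebra complex.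
From mathcomp Require Import all_classical all_reals all_analysis.
From mathcomp Require Import ring lra.

Set Implicit Arguments.
Unset Strict Implicit.
Unset Printing Implicit Defensive.

Import Order.TTheory GRing.Theory Num.Theory.
Import numFieldNormedType.Exports.

Local Open Scope classical_set_scope.
Local Open Scope ring_scope.
Local Open Scope complex_scope.

(* R[i] gets the topology of its modulus, as a normed module over itself, so
   that [derivable] and [derive1] at type R[i] are complex differentiability
   and the complex derivative. *)
HB.instance Definition _ (R : rcfType) := NormedModule.copy R[i] R[i]^o.

(* The library's norm on R[i] takes its (real) values in R[i]. *)
Definition modulus (R : rcfType) (z : R[i]) : R := complex.Re `|z|.

Definition disk (R : rcfType) (r : R) : set R[i] := [set z | modulus z < r].

Definition holomorphic (R : rcfType) (D : set R[i]) (f : R[i] -> R[i]) :=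
  forall z, D z -> derivable f z 1.

Definition domain (R : rcfType) (Omega : set R[i]) :=
  [/\ Omega !=set0, open Omega & connected Omega].

(* [f] is total, only its values on the unit disk are constrained. *)
Definition conformal_map (R : rcfType) (f : R[i] -> R[i]) (Omega : set R[i]) :=
  [/\ holomorphic (disk 1) f, {in disk 1 &, injective f}, domain Omega
    & f @` disk 1 = Omega].

Definition circle (R : realType) (r t : R) : R[i] :=
  (r * cos t) +i* (r * sin t).

(* The integral of [g] over the circle of radius [r] with respect to |dz|. *)
Definition circle_integral (R : realType) (r : R) (g : R[i] -> R) : \bar R :=
  (\int[lebesgue_measure]_(t in `[0%R, (2 * pi)%R]) (g (circle r t) * r)%:E)%E.

Definition spherical_derivative (R : realType) (f : R[i] -> R[i]) (z : R[i]) : R :=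
  modulus (derive1 f z) / (1 + modulus (f z) ^+ 2).

Definition Lambda_sph (R : realType) (f : R[i] -> R[i]) : \bar R :=
  ereal_sup [set circle_integral r (spherical_derivative f) | r in `]0%R, 1%R[].

(* [None] is the point at infinity. *)
Definition riemann_sphere (R : realType) := option R[i].
HB.instance Definition _ (R : realType) := Choice.on (riemann_sphere R).

Definition to_sphere (R : realType) (z : R[i]) : riemann_sphere R := Some z.

Section SphericalMetric.
Context {R : realType}.

Local Notation vec := (R * R * R)%type.

Definition dot3 (u v : vec) : R :=
  u.1.1 * v.1.1 + u.1.2 * v.1.2 + u.2 * v.2.

(* Inverse stereographic projection onto the unit sphere of R^3. *)
Definition stereo (p : riemann_sphere R) : vec :=
  if p is Some (x +i* y) then
    let d := 1 + x ^+ 2 + y ^+ 2 in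
    (2 * x / d, 2 * y / d, (x ^+ 2 + y ^+ 2 - 1) / d)
  else (0, 0, 1).

(* The geodesic distance of the metric |dz| / (1 + |z|^2) appearing in
   [Lambda_sph]: [stereo] carries 2 |dz| / (1 + |z|^2) to arc length on the unit
   sphere, where the distance of two unit vectors is the angle between them. *)
Definition spherical_dist (p q : riemann_sphere R) : R :=
  acos (dot3 (stereo p) (stereo q)) / 2.

Let den_gt0 (x y : R) : 0 < 1 + x ^+ 2 + y ^+ 2.
Proof. by rewrite -addrA ltr_pwDl// addr_ge0// sqr_ge0. Qed.

Lemma dot3_stereo p : dot3 (stereo p) (stereo p) = 1.
Proof.
case: p => [[x y]|]; rewrite /dot3 /=; last by rewrite !mulr0 !add0r mulr1.
have d0 := lt0r_neq0 (den_gt0 x y); by field.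
Qed.

Lemma stereo_inj : injective stereo.
Proof.
have key (x y : R) : (x ^+ 2 + y ^+ 2 - 1) / (1 + x ^+ 2 + y ^+ 2)
    = 1 - 2 / (1 + x ^+ 2 + y ^+ 2).
  by have d0 := lt0r_neq0 (den_gt0 x y); field.
have key1 (x y : R) : 1 - 2 / (1 + x ^+ 2 + y ^+ 2) <> 1.
  move=> /eqP; rewrite -subr_eq0 addrAC subrr add0r oppr_eq0.
  by rewrite mulf_eq0 pnatr_eq0 invr_eq0 (negPf (lt0r_neq0 (den_gt0 x y))).
have two0 : 2 != 0 :> R by rewrite pnatr_eq0.
case=> [[x y]|] [[x' y']|] //= [hx hy hz].
- move: hz; rewrite !key => /addrI/oppr_inj/(mulfI two0)/invr_inj hd.
  have i0 : (1 + x' ^+ 2 + y' ^+ 2)^-1 != 0 by rewrite invr_eq0 lt0r_neq0.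
  move: hx hy; rewrite hd => /(mulIf i0)/(mulfI two0) ->.
  by move=> /(mulIf i0)/(mulfI two0) ->.
- by case: (key1 x y); rewrite -key.
- by case: (key1 x' y'); rewrite -key.
Qed.

Lemma dot3C u v : dot3 u v = dot3 v u.
Proof. by rewrite /dot3; ring. Qed.

Lemma dot3_bound u v : dot3 u u = 1 -> dot3 v v = 1 -> -1 <= dot3 u v <= 1.
Proof.
move=> hu hv; apply/andP; split.
  have : 0 <= (u.1.1 + v.1.1) ^+ 2 + (u.1.2 + v.1.2) ^+ 2 + (u.2 + v.2) ^+ 2.
    by rewrite !addr_ge0// sqr_ge0.
  by move: hu hv; rewrite /dot3 => hu hv h; lra.
have : 0 <= (u.1.1 - v.1.1) ^+ 2 + (u.1.2 - v.1.2) ^+ 2 + (u.2 - v.2) ^+ 2.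
  by rewrite !addr_ge0// sqr_ge0.
by move: hu hv; rewrite /dot3 => hu hv h; lra.
Qed.

Lemma dot3_eq1 u v : dot3 u u = 1 -> dot3 v v = 1 -> dot3 u v = 1 -> u = v.
Proof.
case: u v => [[a b] c] [[a' b'] c']; rewrite /dot3/= => hu hv huv.
have h : (a - a') ^+ 2 + (b - b') ^+ 2 + (c - c') ^+ 2 = 0 by lra.
move/eqP: h; rewrite !paddr_eq0 ?addr_ge0 ?sqr_ge0// !sqrf_eq0 !subr_eq0.
by move=> /andP[/andP[/eqP-> /eqP->] /eqP->].
Qed.

(* Nonnegativity of the Gram determinant of three unit vectors. *)
Lemma dot3_gram u v w : dot3 u u = 1 -> dot3 v v = 1 -> dot3 w w = 1 ->
  (dot3 u v * dot3 v w - dot3 u w) ^+ 2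
    <= (1 - dot3 u v ^+ 2) * (1 - dot3 v w ^+ 2).
Proof.
move=> hu hv hw; rewrite -subr_ge0.
set g := (X in 0 <= X).
suff -> : g = (u.1.1 * (v.1.2 * w.2 - v.2 * w.1.2)
             - u.1.2 * (v.1.1 * w.2 - v.2 * w.1.1)
             + u.2 * (v.1.1 * w.1.2 - v.1.2 * w.1.1)) ^+ 2 by exact: sqr_ge0.
transitivity (dot3 u u * dot3 v v * dot3 w w
  + 2 * (dot3 u v * dot3 v w * dot3 u w) - dot3 u u * dot3 v w ^+ 2
  - dot3 v v * dot3 u w ^+ 2 - dot3 w w * dot3 u v ^+ 2).
  by rewrite hu hv hw /g; ring.
by rewrite /dot3; ring.
Qed.

Lemma spherical_distxx p : spherical_dist p p = 0.
Proof. by rewrite /spherical_dist dot3_stereo acos1 mul0r. Qed.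

Let bnd p q : -1 <= dot3 (stereo p) (stereo q) <= 1.
Proof. by apply: dot3_bound; exact: dot3_stereo. Qed.

Lemma spherical_dist_eq0 p q : spherical_dist p q = 0 -> p = q.
Proof.
move=> /eqP; rewrite mulf_eq0 invr_eq0 pnatr_eq0 orbF => /eqP h.
apply/stereo_inj/dot3_eq1; rewrite ?dot3_stereo//.
by rewrite -[LHS]acosK ?in_itv//= h cos0.
Qed.

Lemma spherical_dist_sym p q : spherical_dist p q = spherical_dist q p.
Proof. by rewrite /spherical_dist dot3C. Qed.

Lemma spherical_dist_triangle q p s :
  spherical_dist p s <= spherical_dist p q + spherical_dist q s.
Proof.
rewrite /spherical_dist -mulrDl ler_pM2r ?invr_gt0//.
set a := dot3 (stereo p) (stereo q); set b := dot3 (stereo q) (stereo s).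
set c := dot3 (stereo p) (stereo s).
have [ab|ab] := leP pi (acos a + acos b).
  by apply: le_trans ab; exact: acos_lepi (bnd _ _).
rewrite leNgt -ltr_cos; last 2 first.
- by rewrite in_itv/= (ltW ab) andbT addr_ge0// acos_ge0 ?bnd.
- by rewrite in_itv/= acos_ge0 ?acos_lepi ?bnd.
rewrite -leNgt.
rewrite cosD !acosK ?in_itv/= ?bnd// !sin_acos ?bnd//.
have sq (t : R) : -1 <= t <= 1 -> 0 <= 1 - t ^+ 2 by move=> ?; nra.
rewrite -sqrtrM ?sq ?bnd// lerBlDl -lerBlDr.
apply: le_trans (ler_norm _) _; rewrite -sqrtr_sqr ler_wsqrtr//.
by apply: dot3_gram; exact: dot3_stereo.
Qed.

End SphericalMetric.

HB.instance Definition _ (R : realType) := @isMetric.Build R (riemann_sphere R)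
  spherical_dist spherical_distxx spherical_dist_eq0 spherical_dist_sym
  spherical_dist_triangle.

Definition boundary (T : topologicalType) (A : set T) : set T :=
  closure A `\` interior A.

(* Local connectedness of the subspace [A]: the relatively open subsets of [A]
   are the [V `&` A] with [V] open. *)
Definition locally_connected (T : topologicalType) (A : set T) :=
  forall x U, A x -> open U -> U x ->
  exists V : set T, [/\ open V, V x, V `&` A `<=` U & connected (V `&` A)].

(* Main.v *)
(* Write gamma_r for the image of the circle |z| = r on the sphere. By hypothesis
   the curves gamma_r have bounded spherical length, so reparametrized by arc
   length they form an equicontinuous family of paths on one interval [0, L].
   Their limit along an ultrafilter r -> 1 is a continuous path. Since f is open
   and injective, the image of that path is the boundary: points f(z), |z| -> 1,
   only accumulate on the boundary, and a short segment (or a ray, near infinity)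
   from a boundary point to a point of f(D_r) has to cross gamma_r. A continuous
   image of a segment in a Hausdorff space is locally connected.

   The complex analysis needed is the continuity of f' and the openness of f.
   Both follow from the mean value property on circles, which is Goursat's
   theorem on rectangles for h(z + exp w), where the horizontal sides cancel by
   periodicity. *)

Require Import Defs.
From HB Require Import structures.
From mathcomp Require Import all_boot all_order all_algebra complex.
From mathcomp Require Import all_classical all_reals all_analysis.
From mathcomp Require Import ring lra.

Set Implicit Arguments.
Unset Strict Implicit.
Unset Printing Implicit Defensive.

Import Order.TTheory GRing.Theory Num.Theory.
Import numFieldNormedType.Exports.

Local Open Scope classical_set_scope.
Local Open Scope ring_scope.

(** * Integrals over segments and Goursat's theorem *)

(** Only real integrals occur. Goursat's theorem is applied to the closed form Im(h(z + exp w) dw),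
    whose integral over a vertical side is a mean of Re h over a circle. A constant factor of
    modulus 1 in front of h makes real parts sufficient. The mean value property tolerates a
    puncture at the centre, where only a limit is required. It thus applies to the difference
    quotient of f, whose limit is f', and yields continuity of f' without power series. Continuity
    of f' makes the spherical speed continuous, so arc length is a differentiable primitive of it.
    Lipschitz bounds are proved for the coordinates of [stereo] in R^3, since acos is not
    differentiable at 1 and -1. Arc length is not inverted: parameters with the same arc length have
    the same image point, so any choice of preimages will do. A neighbourhood of a boundary point
    meets gamma_r for all r close to 1, not merely for a sequence of radii. Hence every ultrafilter
    tending to 1 from the left gives a path that covers the whole boundary. *)

Section SegmentIntegral.
Context {R : realType}.
Implicit Types (f g : R -> R) (a b c : R).

Definition seg_int a b f : R := \int[lebesgue_measure]_(x in `[a, b]) f x.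

Definition seg_continuous a b f :=
  forall x, a <= x <= b -> {for x, continuous f}.

Lemma seg_continuous_within a b f : seg_continuous a b f ->
  {within `[a, b], continuous f}.
Proof.
move=> cf; apply: continuous_in_subspaceT => x; rewrite inE/= in_itv/=.
exact: cf.
Qed.

Lemma seg_integrable a b f : seg_continuous a b f ->
  lebesgue_measure.-integrable `[a, b] (EFin \o f).
Proof.
move=> cf; apply: continuous_compact_integrable; first exact: segment_compact.
exact: seg_continuous_within.
Qed.

Lemma eq_seg_int a b f g : (forall x, a <= x <= b -> f x = g x) ->
  seg_int a b f = seg_int a b g.
Proof.
by move=> fg; apply: eq_Rintegral => x; rewrite inE/= in_itv/=; exact: fg.
Qed.

Lemma seg_int_split c a b f : a <= c -> c <= b -> seg_continuous a b f ->
  seg_int a b f = seg_int a c f + seg_int c b f.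
Proof.
move=> ac cb cf; rewrite /seg_int.
have := @Rintegral_itvB R f (BLeft a) (BRight b) c (seg_integrable cf).
rewrite !bnd_simp => /(_ ac cb) /eqP.
rewrite subr_eq => /eqP ->; rewrite addrC; congr (_ + _).
apply: Rintegral_itv_obnd_cbnd.
apply: integrableS (seg_integrable cf) => //.
by apply: subset_itvr; rewrite bnd_simp.
Qed.

Lemma seg_intB a b f g : seg_continuous a b f -> seg_continuous a b g ->
  seg_int a b (fun x => f x - g x) = seg_int a b f - seg_int a b g.
Proof. by move=> cf cg; apply: RintegralB => //; exact: seg_integrable. Qed.

Lemma seg_int_cst a b c : a <= b -> seg_int a b (fun=> c) = c * (b - a).
Proof.
move=> ab; rewrite /seg_int Rintegral_cst//= lebesgue_measure_itv/=.
rewrite lte_fin; case: ltP => [_|ba]; first by rewrite -EFinD.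
by rewrite (@le_anti _ _ a b) ?ab ?subrr.
Qed.

Lemma le_seg_int a b f g : seg_continuous a b f -> seg_continuous a b g ->
  (forall x, a <= x <= b -> f x <= g x) -> seg_int a b f <= seg_int a b g.
Proof.
move=> cf cg fg; apply: le_Rintegral => //; exact: seg_integrable.
Qed.

Lemma seg_int_bound a b f m e : a <= b -> seg_continuous a b f ->
  (forall x, a <= x <= b -> `|f x - m| <= e) ->
  `|seg_int a b f - m * (b - a)| <= e * (b - a).
Proof.
move=> ab cf fe.
have cc c : seg_continuous a b (fun=> c) by move=> x _; exact: cvg_cst.
have h1 : seg_int a b f <= seg_int a b (fun=> m + e).
  by apply: le_seg_int => // x /fe; rewrite ler_distl; lra.
have h2 : seg_int a b (fun=> m - e) <= seg_int a b f.
  by apply: le_seg_int => // x /fe; rewrite ler_distl; lra.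
by move: h1 h2; rewrite !seg_int_cst// ler_distl; lra.
Qed.

Lemma seg_mean_dist p f g mf mg e : 0 < p ->
  seg_continuous 0 p f -> seg_continuous 0 p g ->
  seg_int 0 p f = p * mf -> seg_int 0 p g = p * mg ->
  (forall x, 0 <= x <= p -> `|f x - g x| <= e) -> `|mf - mg| <= e.
Proof.
move=> p0 cf cg If Ig fge.
have cfg : seg_continuous 0 p (fun x => f x - g x).
  by move=> x xp; apply: cvgB; [exact: cf|exact: cg].
have := @seg_int_bound 0 p (fun x => f x - g x) 0 e (ltW p0) cfg.
rewrite mul0r !subr0 seg_intB// If Ig -mulrBr normrM gtr0_norm//.
rewrite [e * p]mulrC ler_pM2l//; apply=> x xp; rewrite subr0; exact: fge.
Qed.

End SegmentIntegral.

Section Circulation.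
Context {R : realType}.
Implicit Types (P Q : R -> R -> R) (a b c d x y p k q e : R).

(** Total differentiability at a single point, with the l1 norm. Nothing is asked of the partial
    derivatives [p], [q] at other points, as Goursat's argument demands. *)
Definition fdiff P x y p q := forall e : R, 0 < e -> exists2 r : R, 0 < r &
  forall u v, `|u - x| < r -> `|v - y| < r ->
  `|P u v - P x y - p * (u - x) - q * (v - y)| <= e * (`|u - x| + `|v - y|).

Lemma continuous_eps (f : R -> R) x :
  (forall e : R, 0 < e -> exists2 r : R, 0 < r &
     forall u, `|u - x| < r -> `|f u - f x| <= e) -> {for x, continuous f}.
Proof.
move=> H; apply/cvgrPdist_le => e e0; have [r r0 hr] := H _ e0.
apply/nbhs_ballP; exists r => // t; rewrite /ball/= distrC => /hr.
by rewrite distrC.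
Qed.

Lemma fdiff_continuous1 P x y p q : fdiff P x y p q ->
  {for x, continuous (P^~ y)}.
Proof.
move=> h; apply: continuous_eps => e e0; have [r r0 hr] := h 1 ltr01.
have k0 : 0 < `|p| + 1 by apply: ltr_pwDr.
exists (Num.min r (e / (`|p| + 1))); first by rewrite lt_min r0 divr_gt0.
move=> u; rewrite lt_min ltr_pdivlMr// => /andP[ur ue].
have := hr u y ur; rewrite subrr normr0 => /(_ r0).
rewrite mulr0 subr0 addr0 mul1r => hu.
have -> : P u y - P x y = (P u y - P x y - p * (u - x)) + p * (u - x) by ring.
apply: le_trans (ler_normD _ _) _; rewrite normrM; nra.
Qed.

Lemma fdiff_swap P x y p q : fdiff P x y p q ->
  fdiff (fun v u => P u v) y x q p.
Proof.
move=> h e e0; have [r r0 hr] := h e e0; exists r => // v u vr ur.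
have := hr u v ur vr; rewrite [_ + `|v - y|]addrC; congr (`|_| <= _); ring.
Qed.

Lemma fdiff_continuous2 P x y p q : fdiff P x y p q ->
  {for y, continuous (P x)}.
Proof. by move/fdiff_swap/fdiff_continuous1. Qed.

(** The integral of P dx + Q dy along the boundary of [a, b] x [c, d], counterclockwise. Opposite
    sides are paired because their difference is what differentiability makes small. *)
Definition circulation P Q a b c d : R :=
  seg_int a b (fun x => P x c - P x d) + seg_int c d (fun y => Q b y - Q a y).

(** The shared [k] is the closedness condition P_y = Q_x. *)
Definition closed_on P Q a b c d := forall x y, a <= x <= b -> c <= y <= d ->
  exists p k q, fdiff P x y p k /\ fdiff Q x y k q.

Lemma closed_onS P Q a b c d a' b' c' d' :
  a <= a' -> b' <= b -> c <= c' -> d' <= d ->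
  closed_on P Q a b c d -> closed_on P Q a' b' c' d'.
Proof. by move=> aa bb cc dd h x y ? ?; apply: h; lra. Qed.

Lemma closed_on_cont1 P Q a b c d y : closed_on P Q a b c d -> c <= y <= d ->
  seg_continuous a b (P^~ y).
Proof.
move=> h cyd x axb; have [p [k [q [hp _]]]] := h x y axb cyd.
exact: fdiff_continuous1 hp.
Qed.

Lemma closed_on_cont2 P Q a b c d x : closed_on P Q a b c d -> a <= x <= b ->
  seg_continuous c d (Q x).
Proof.
move=> h axb y cyd; have [p [k [q [_ hq]]]] := h x y axb cyd.
exact: fdiff_continuous2 hq.
Qed.

Lemma circulationE P Q a b c d : a <= b -> c <= d -> closed_on P Q a b c d ->
  circulation P Q a b c d =
  seg_int a b (P^~ c) - seg_int a b (P^~ d) + (seg_int c d (Q b) - seg_int c d (Q a)).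
Proof.
move=> ab cd h; rewrite /circulation !seg_intB//;
  by [apply: (closed_on_cont1 h); lra|apply: (closed_on_cont2 h); lra].
Qed.

Lemma circulation_splitx P Q a m b c d : a <= m -> m <= b -> c <= d ->
  closed_on P Q a b c d ->
  circulation P Q a b c d = circulation P Q a m c d + circulation P Q m b c d.
Proof.
move=> am mb cd h.
rewrite !circulationE//; try lra; do ?[by apply: closed_onS h; lra].
have c1 y : c <= y <= d -> seg_int a b (P^~ y) = _ :=
  fun hy => seg_int_split am mb (closed_on_cont1 h hy).
rewrite !c1; try lra; ring.
Qed.

Lemma circulation_splity P Q a b c m d : a <= b -> c <= m -> m <= d ->
  closed_on P Q a b c d ->
  circulation P Q a b c d = circulation P Q a b c m + circulation P Q a b m d.
Proof.
move=> ab cm md h.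
rewrite !circulationE//; try lra; do ?[by apply: closed_onS h; lra].
have c1 x : a <= x <= b -> seg_int c d (Q x) = _ :=
  fun hx => seg_int_split cm md (closed_on_cont2 h hx).
rewrite !c1; try lra; ring.
Qed.

(* Near a point of differentiability the linear parts of [P dx + Q dy] cancel
   because P_y = Q_x, and only the remainders contribute. *)
Lemma circulation_small P Q x y p k q e : 0 < e ->
  fdiff P x y p k -> fdiff Q x y k q ->
  exists2 r, 0 < r & forall a b c d, a <= x <= b -> c <= y <= d ->
    b - a < r -> d - c < r -> closed_on P Q a b c d ->
    `|circulation P Q a b c d| <= e * (b - a + (d - c)) ^+ 2.
Proof.
move=> e0 hP hQ; have e20 : 0 < e / 2 by lra.
have [r1 r10 h1] := hP _ e20; have [r2 r20 h2] := hQ _ e20.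
exists (Num.min r1 r2); first by rewrite lt_min r10.
move=> a b c d axb cyd; rewrite !lt_min => /andP[b1 b2] /andP[d1 d2] h.
have ab : a <= b by lra.
have cd : c <= d by lra.
pose s := b - a + (d - c).
have near_x u : a <= u <= b -> `|u - x| <= b - a.
  by move=> hu; rewrite ler_norml; lra.
have near_y v : c <= v <= d -> `|v - y| <= d - c.
  by move=> hv; rewrite ler_norml; lra.
have HP u v : a <= u <= b -> c <= v <= d ->
    `|P u v - P x y - p * (u - x) - k * (v - y)| <= e / 2 * s.
  move=> /near_x hu /near_y hv.
  apply: le_trans (h1 u v _ _) _; [lra|lra|].
  by rewrite ler_pM2l//; rewrite /s; lra.
have HQ u v : a <= u <= b -> c <= v <= d ->
    `|Q u v - Q x y - k * (u - x) - q * (v - y)| <= e / 2 * s.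
  move=> /near_x hu /near_y hv.
  apply: le_trans (h2 u v _ _) _; [lra|lra|].
  by rewrite ler_pM2l//; rewrite /s; lra.
have I1 : `|seg_int a b (fun x => P x c - P x d) - k * (c - d) * (b - a)|
    <= e * s * (b - a).
  apply: seg_int_bound => //.
    by move=> u hu; apply: cvgB; apply: (closed_on_cont1 h) => //; lra.
  move=> u hu; have := HP u c hu ltac:(lra); have := HP u d hu ltac:(lra).
  rewrite !ler_norml; lra.
have I2 : `|seg_int c d (fun y => Q b y - Q a y) - k * (b - a) * (d - c)|
    <= e * s * (d - c).
  apply: seg_int_bound => //.
    by move=> u hu; apply: cvgB; apply: (closed_on_cont2 h) => //; lra.
  move=> u hu; have := HQ a u ltac:(lra) hu; have := HQ b u ltac:(lra) hu.
  rewrite !ler_norml; lra.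
rewrite /circulation -/s.
have -> : e * s ^+ 2 = e * s * (b - a) + e * s * (d - c) by rewrite /s; ring.
by move: I1 I2; rewrite !ler_norml; lra.
Qed.

(** Every left end lies below every right end, so the supremum of the left ends belongs to all the
    segments. *)
Lemma nested_segments (a w : nat -> R) :
  (forall n, a n <= a n.+1) -> (forall n, a n.+1 + w n.+1 <= a n + w n) ->
  (forall n, 0 <= w n) -> exists x, forall n, a n <= x <= a n + w n.
Proof.
move=> ha hw w0.
have na m n : a m <= a (m + n)%N.
  by elim: n => [|n IH]; rewrite ?addn0// addnS (le_trans IH).
have nw m n : a (m + n)%N + w (m + n)%N <= a m + w m.
  by elim: n => [|n IH]; rewrite ?addn0// addnS (le_trans _ IH).
have am m n : a m <= a n + w n.
  have [mn|nm] := leqP m n.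
    by have := na m (n - m)%N; rewrite subnKC//; have := w0 n; lra.
  by have := nw n (m - n)%N; rewrite subnKC 1?ltnW//; have := w0 m; lra.
have ubw n : ubound (range a) (a n + w n) by move=> _ [m _ <-].
exists (sup (range a)) => n; apply/andP; split.
  by apply: ub_le_sup; [exists (a 0 + w 0)|exists n].
by apply: ge_sup => //; exists (a 0), 0.
Qed.

End Circulation.

Section Goursat.
Context {R : realType}.
Implicit Types (P Q : R -> R -> R) (a b c d x y p k q e : R).

Lemma circulation_quarter P Q x y w h : 0 <= w -> 0 <= h ->
  closed_on P Q x (x + w + w) y (y + h + h) ->
  circulation P Q x (x + w + w) y (y + h + h) =
  circulation P Q x (x + w) y (y + h) +
  circulation P Q x (x + w) (y + h) (y + h + h) +
  (circulation P Q (x + w) (x + w + w) y (y + h) +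
   circulation P Q (x + w) (x + w + w) (y + h) (y + h + h)).
Proof.
move=> w0 h0 hD.
have xw u : u <= u + w by rewrite lerDl.
have yh u : u <= u + h by rewrite lerDl.
rewrite (@circulation_splitx _ P Q _ (x + w))//; last first.
  exact: le_trans (yh _).
by congr (_ + _); rewrite (@circulation_splity _ P Q _ _ _ (y + h))//;
  apply: closed_onS hD.
Qed.

Theorem goursat P Q a b c d : a <= b -> c <= d -> closed_on P Q a b c d ->
  circulation P Q a b c d = 0.
Proof.
move=> ab cd h; apply/eqP; rewrite -normr_eq0 eq_le normr_ge0 andbT leNgt.
apply/negP => J0.
pose W n := (b - a) / 2 ^+ n; pose H n := (d - c) / 2 ^+ n.
have W2 n : W n = 2 * W n.+1.
  by rewrite /W exprS; have : (2 ^+ n : R) != 0 by []; move=> h0; field.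
have H2 n : H n = 2 * H n.+1.
  by rewrite /H exprS; have : (2 ^+ n : R) != 0 by []; move=> h0; field.
have Wge n : 0 <= W n by rewrite divr_ge0 ?exprn_ge0// subr_ge0.
have Hge n : 0 <= H n by rewrite divr_ge0 ?exprn_ge0// subr_ge0.
(* This [e] makes the whole rectangle violate the bound of [circulation_small]. The [+ 1] in the
   witness keeps [e] positive when the rectangle is a point. *)
have [e e0 he] : exists2 e : R, 0 < e &
    e * (b - a + (d - c)) ^+ 2 < `|circulation P Q a b c d|.
  have k0 : 0 < (b - a + (d - c)) ^+ 2 + 1 by rewrite ltr_wpDl ?sqr_ge0.
  exists (`|circulation P Q a b c d| / ((b - a + (d - c)) ^+ 2 + 1)).
    by rewrite divr_gt0.
  by rewrite mulrAC ltr_pdivrMr// ltr_pM2l// ltrDl.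
(* The bound e (w + h)^2 is divided by 4 under bisection, so a rectangle that
   violates it has a quarter that violates it too. *)
pose bad n (z : R * R) := [/\ a <= z.1, z.1 + W n <= b, c <= z.2, z.2 + H n <= d &
  e * (W n + H n) ^+ 2 < `|circulation P Q z.1 (z.1 + W n) z.2 (z.2 + H n)|].
have step (nz : nat * (R * R)) : exists z', bad nz.1 nz.2 ->
    [/\ bad nz.1.+1 z', nz.2.1 <= z'.1, nz.2.2 <= z'.2,
      z'.1 + W nz.1.+1 <= nz.2.1 + W nz.1 &
      z'.2 + H nz.1.+1 <= nz.2.2 + H nz.1].
  case: nz => n [x y] /=; apply: contrapT => /forallNP hN.
  have [/= ax xb cy yd] : bad n (x, y).
    by apply: contrapT => nb; apply: (hN (x, y)) => /nb.
  apply/negP; rewrite -leNgt.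
  have := Wge n.+1; have := Hge n.+1.
  set w := W n.+1; set h1 := H n.+1 => h10 w0.
  have bnd x' y' : x' \in [:: x; x + w] -> y' \in [:: y; y + h1] ->
      `|circulation P Q x' (x' + w) y' (y' + h1)| <= e * (w + h1) ^+ 2.
    move=> hx hy; rewrite leNgt; apply/negP => hb; apply: (hN (x', y')) => _ /=.
    rewrite W2 H2 -/w -/h1 in xb yd *.
    have {hx} hx : x <= x' /\ x' + w <= x + 2 * w.
      by move: hx; rewrite !inE => /orP[]/eqP ->; lra.
    have {hy} hy : y <= y' /\ y' + h1 <= y + 2 * h1.
      by move: hy; rewrite !inE => /orP[]/eqP ->; lra.
    case: hx hy => x1 x2 [y1 y2]; split=> //.
    by split=> //; [exact: le_trans x1|exact: le_trans xb|
      exact: le_trans y1|exact: le_trans yd].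
  rewrite W2 H2 -/w -/h1 in xb yd *.
  have e2w : x + 2 * w = x + w + w by ring.
  have e2h : y + 2 * h1 = y + h1 + h1 by ring.
  have hD : closed_on P Q x (x + 2 * w) y (y + 2 * h1) by apply: closed_onS h; lra.
  rewrite e2w e2h in hD *; rewrite circulation_quarter//.
  have -> : e * (2 * w + 2 * h1) ^+ 2 = 4 * (e * (w + h1) ^+ 2) by ring.
  have m1 := bnd x y; have m2 := bnd x (y + h1).
  have m3 := bnd (x + w) y; have m4 := bnd (x + w) (y + h1).
  move: m1 m2 m3 m4; rewrite !inE !eqxx !orbT => /(_ isT isT) + /(_ isT isT).
  move=> + + /(_ isT isT) + /(_ isT isT); rewrite !ler_norml; lra.
have [nx hnx] := choice step.
pose u := fix u n := if n is n'.+1 then nx (n', u n') else (a, c).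
have bad0 : bad 0%N (a, c).
  by split=> //=; rewrite /W /H expr0 !divr1 ?[a + _]addrC ?[c + _]addrC ?subrK.
have badu n : bad n (u n).
  by elim: n => //= n IH; have [] := hnx (n, u n) IH.
have [x hx] : exists x, forall n, (u n).1 <= x <= (u n).1 + W n.
  by apply: nested_segments => // n; have [] := hnx (n, u n) (badu n).
have [y hy] : exists x, forall n, (u n).2 <= x <= (u n).2 + H n.
  by apply: nested_segments => // n; have [] := hnx (n, u n) (badu n).
have [p [k [q [hP hQ]]]] : exists p k q, fdiff P x y p k /\ fdiff Q x y k q.
  by apply: h; [have [] := badu 0%N; have := hx 0%N|have [] := badu 0%N; have := hy 0%N]; lra.
have [r r0 hr] := circulation_small e0 hP hQ.
have [n [Wn Hn]] : exists n, W n < r /\ H n < r.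
  have k0 : 0 < r / (b - a + (d - c) + 1) by rewrite divr_gt0//; lra.
  have : (fun n => (1 / 2 : R) ^+ n) @ \oo --> (0 : R).
    by apply: cvg_expr; rewrite ger0_norm; lra.
  move/cvgrPdist_lt => /(_ _ k0) [N _ /(_ N (leqnn _))].
  rewrite sub0r normrN ger0_norm ?exprn_ge0; [|lra..].
  rewrite expr_div_n expr1n ltr_pdivlMr; [|lra].
  exists N; rewrite /W /H; have N0 : 0 < (2^+N : R)^-1 by rewrite invr_gt0 exprn_gt0.
  by split; nra.
have [ax xb cy yd] := badu n; apply/negP; rewrite -leNgt.
have := hr (u n).1 ((u n).1 + W n) (u n).2 ((u n).2 + H n) (hx n) (hy n).
have eW : (u n).1 + W n - (u n).1 = W n by ring.
have eH : (u n).2 + H n - (u n).2 = H n by ring.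
rewrite eW eH; apply=> //.
by apply: closed_onS h.
Qed.

End Goursat.

(** * Complex differentiability *)

Section Modulus.
Context {R : rcfType}.
Implicit Types z w : R[i].

Lemma modulusE z : `|z| = (modulus z)%:C%C.
Proof. by rewrite /modulus normc_def. Qed.

Lemma modulus_ge0 z : 0 <= modulus z.
Proof. by rewrite -lecR -modulusE normr_ge0. Qed.

Lemma modulus0 : modulus (0 : R[i]) = 0.
Proof. by apply: complexI; rewrite -modulusE normr0. Qed.

Lemma modulus1 : modulus (1 : R[i]) = 1.
Proof. by apply: complexI; rewrite -modulusE normr1. Qed.

Lemma modulus_eq0 z : (modulus z == 0) = (z == 0).
Proof. by rewrite -(inj_eq (@complexI R)) -modulusE normr_eq0. Qed.

Lemma modulus_gt0 z : (0 < modulus z) = (z != 0).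
Proof. by rewrite lt_neqAle modulus_ge0 eq_sym modulus_eq0 andbT. Qed.

Lemma modulusM z w : modulus (z * w) = modulus z * modulus w.
Proof. by apply: complexI; rewrite rmorphM /= -!modulusE normrM. Qed.

Lemma modulusV z : modulus z^-1 = (modulus z)^-1.
Proof. by apply: complexI; rewrite fmorphV /= -!modulusE normfV. Qed.

Lemma modulusN z : modulus (- z) = modulus z.
Proof. by apply: complexI; rewrite -!modulusE normrN. Qed.

Lemma modulusD z w : modulus (z + w) <= modulus z + modulus w.
Proof. by rewrite -lecR rmorphD /= -!modulusE ler_normD. Qed.

Lemma modulusB z w : modulus (z - w) = modulus (w - z).
Proof. by rewrite -modulusN opprB. Qed.

Lemma modulus_tri v z w : modulus (z - w) <= modulus (z - v) + modulus (v - w).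
Proof. by apply: le_trans (modulusD _ _); rewrite addrA subrK. Qed.

Lemma modulus_def (x y : R) : modulus (x +i* y)%C = Num.sqrt (x ^+ 2 + y ^+ 2).
Proof. by rewrite /modulus normc_def. Qed.

Lemma sqr_modulus z : modulus z ^+ 2 = complex.Re z ^+ 2 + complex.Im z ^+ 2.
Proof. by case: z => x y; rewrite modulus_def sqr_sqrtr ?addr_ge0 ?sqr_ge0. Qed.

Lemma Re_le_modulus z : `|complex.Re z| <= modulus z.
Proof. by rewrite -lecR -modulusE normc_ge_Re. Qed.

Lemma Im_le_modulus z : `|complex.Im z| <= modulus z.
Proof.
rewrite -(ler_pXn2r (_ : 0 < 2)%N) ?nnegrE ?modulus_ge0//.
by rewrite sqr_modulus real_normK ?num_real// lerDr sqr_ge0.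
Qed.

Lemma modulus_le_ReIm z : modulus z <= `|complex.Re z| + `|complex.Im z|.
Proof.
rewrite -(ler_pXn2r (_ : 0 < 2)%N) ?nnegrE ?modulus_ge0 ?addr_ge0//.
rewrite sqr_modulus sqrrD !real_normK ?num_real//.
by rewrite -addrA lerD2l lerDr mulrn_wge0// mulr_ge0.
Qed.

Lemma modulus_real (x : R) : modulus x%:C%C = `|x|.
Proof. by rewrite modulus_def expr0n addr0 sqrtr_sqr. Qed.

End Modulus.

(** Stated over any numeric field because it serves both the real and the complex derivative. The
    remainder form also covers [w = z], which the punctured limit excludes. *)
Lemma derivable_eps (K : numFieldType) (f : K -> K) z : derivable f z 1 ->
  forall e, 0 < e -> exists2 r, 0 < r & forall w, `|w - z| < r ->
    `|f w - f z - derive1 f z * (w - z)| <= e * `|w - z|.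
Proof.
move=> df e e0.
have : (fun h => h^-1 *: (f (h + z) - f z)) @ 0^' --> derive1 f z.
  move: df; rewrite /derivable /derive1.
  rewrite (_ : (fun h => h^-1 *: (f (h *: 1 + z) - f z)) =
    fun h => h^-1 *: (f (h + z) - f z))//.
  by apply/funext => h; rewrite -[h *: 1]/(h * 1) mulr1.
move/cvgrPdist_le => /(_ _ e0) /nbhs_ballP[r /= r0 hr].
exists r => // w wr; have [->|wz] := eqVneq w z.
  by rewrite !subrr mulr0 subr0 normr0 mulr0.
have wz0 : w - z != 0 by rewrite subr_eq0.
have := hr (w - z); rewrite /ball/= sub0r normrN => /(_ wr wz0).
rewrite subrK => h.
have -> : f w - f z - derive1 f z * (w - z) =
    - ((derive1 f z - (w - z)^-1 *: (f w - f z)) * (w - z)).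
  by rewrite -[_ *: _]/(_ * _); field.
by rewrite normrN normrM ler_pM2r// normr_gt0.
Qed.

Section ComplexTopology.
Context {R : realType}.
Implicit Types (z w l : R[i]) (f g : R[i] -> R[i]).

(** Balls of [R[i]] have radii in [R[i]]; a positive radius is real, so its real part serves. *)
Lemma nbhs_modulusP z (A : set R[i]) : nbhs z A <->
  exists2 e : R, 0 < e & forall w, modulus (w - z) < e -> A w.
Proof.
split=> [/nbhs_ballP[e /= e0 he]|[e e0 he]].
  exists (complex.Re e); first by rewrite ltcE in e0; case/andP: e0.
  move=> w hw; apply: he; rewrite /ball/= distrC modulusE.
  rewrite ltcE /= hw andbT; by rewrite ltcE in e0; case/andP: e0.
apply/nbhs_ballP; exists (e%:C)%C; first by rewrite /= ltcR.
by move=> w; rewrite /ball/= distrC modulusE ltcR; exact: he.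
Qed.

Definition cdiff f z l := forall e : R, 0 < e -> exists2 r : R, 0 < r &
  forall w, modulus (w - z) < r ->
    modulus (f w - f z - l * (w - z)) <= e * modulus (w - z).

Lemma derivable_cdiff f z : derivable f z 1 -> cdiff f z (derive1 f z).
Proof.
move=> df e e0; have e0' : (0 : R[i]) < (e%:C)%C by rewrite ltcR.
have [/= r r0 hr] := derivable_eps df e0'.
exists (complex.Re r); first by move: r0; rewrite ltcE => /andP[].
move=> w wr; rewrite -lecR rmorphM/= -!modulusE; apply: hr.
rewrite modulusE ltcE /= wr andbT.
by move: r0; rewrite ltcE => /andP[].
Qed.

Definition ccont f z := forall e : R, 0 < e -> exists2 r : R, 0 < r &
  forall w, modulus (w - z) < r -> modulus (f w - f z) < e.

Lemma cdiff_ccont f z l : cdiff f z l -> ccont f z.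
Proof.
move=> df e e0; have [r r0 hr] := df 1 ltr01.
have l0 : 0 < modulus l + 2 by rewrite ltr_wpDl ?modulus_ge0.
exists (Num.min r (e / (modulus l + 2))); first by rewrite lt_min r0 divr_gt0.
move=> w; rewrite lt_min ltr_pdivlMr// => /andP[/hr h1 h2].
have -> : f w - f z = (f w - f z - l * (w - z)) + l * (w - z) by ring.
apply: le_lt_trans (modulusD _ _) _; rewrite modulusM.
have := modulus_ge0 (w - z); lra.
Qed.

Lemma derivable_ccont f z : derivable f z 1 -> ccont f z.
Proof. by move/derivable_cdiff/cdiff_ccont. Qed.

End ComplexTopology.

(** * The mean value property *)

Section ComplexExponential.
Context {R : realType}.
Implicit Types (u v x y : R) (z w l : R[i]) (h : R[i] -> R[i]).

Lemma modulus_circle r x : 0 <= r -> modulus (circle r x) = r :> R.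
Proof.
move=> r0; rewrite /circle modulus_def !exprMn -mulrDr cos2Dsin2 mulr1.
by rewrite sqrtr_sqr ger0_norm.
Qed.

Lemma circleM r s x y : circle r x * circle s y = circle (r * s) (x + y) :> R[i].
Proof.
rewrite /circle sinD cosD; apply/eqP; rewrite eq_complex /=.
by apply/andP; split; apply/eqP; ring.
Qed.

Lemma circle_2pi (r : R) : circle r (2 * pi) = circle r 0.
Proof. by rewrite /circle mulr_natl cos2pi sin2pi cos0 sin0. Qed.

Lemma is_derive_eps (f : R -> R) x df : is_derive x 1 f df ->
  forall e : R, 0 < e -> exists2 r : R, 0 < r & forall u, `|u - x| < r ->
    `|f u - f x - df * (u - x)| <= e * `|u - x|.
Proof. by move=> [d <-]; rewrite -derive1E; exact: derivable_eps. Qed.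

(** The point [circle (expR u) v] is exp(u + iv), and the lemma says that exp has derivative 1 at
    0. *)
Lemma cexp_diff0 (e : R) : 0 < e -> exists2 r : R, 0 < r & forall u v,
  `|u| < r -> `|v| < r ->
  modulus (circle (expR u) v - 1 - (u +i* v)%C) <= e * (`|u| + `|v|).
Proof.
(* The coefficients of |v| in [a3], [a4] and [a5] below add up to 2 + 2 + 1 times e / 5. *)
move=> e0; have e5 : 0 < e / 5 by lra.
have [r1 r10 h1] := is_derive_eps (is_derive_expR 0) e5.
have [r2 r20 h2] := is_derive_eps (is_derive_cos 0) e5.
have [r3 r30 h3] := is_derive_eps (is_derive_sin 0) e5.
exists (Num.min 1 (Num.min (e / 5) (Num.min r1 (Num.min r2 r3)))).
  by rewrite !lt_min ltr01 e5 r10 r20 r30.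
move=> u v; rewrite !lt_min => /and5P[u1 ue ur1 _ _] /and5P[_ _ _ vr2 vr3].
have := h1 u; have := h2 v; have := h3 v.
rewrite !subr0 expR0 cos0 sin0 !subr0 oppr0 mul0r !mul1r subr0.
move=> /(_ vr3) {}h3 /(_ vr2) {}h2 /(_ ur1) {}h1.
apply: le_trans (modulus_le_ReIm _) _ => /=.
have eRe : expR u * cos v - 1 - u =
  (expR u - 1 - u) * cos v + (1 + u) * (cos v - 1) by ring.
have eIm : expR u * sin v - 0 - v = (expR u - 1 - u) * sin v +
  (1 + u) * (sin v - v) + u * v by ring.
have cv : `|cos v| <= 1 by rewrite ler_norml cos_geN1 cos_le1.
have sv : `|sin v| <= 1 by rewrite ler_norml sin_geN1 sin_le1.
have u2 : `|1 + u| <= 2 by apply: le_trans (ler_normD _ _) _; rewrite normr1; lra.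
have a1 : `|(expR u - 1 - u) * cos v| <= e / 5 * `|u|.
  by rewrite normrM; apply: le_trans h1; rewrite ler_piMr.
have a2 : `|(expR u - 1 - u) * sin v| <= e / 5 * `|u|.
  by rewrite normrM; apply: le_trans h1; rewrite ler_piMr.
have a3 : `|(1 + u) * (cos v - 1)| <= 2 * (e / 5 * `|v|).
  by rewrite normrM ler_pM.
have a4 : `|(1 + u) * (sin v - v)| <= 2 * (e / 5 * `|v|).
  by rewrite normrM ler_pM.
have a5 : `|u * v| <= e / 5 * `|v| by rewrite normrM ler_wpM2r// ltW.
rewrite eRe eIm.
have b1 := ler_normD ((expR u - 1 - u) * cos v) ((1 + u) * (cos v - 1)).
have b2 := ler_normD ((expR u - 1 - u) * sin v + (1 + u) * (sin v - v)) (u * v).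
have b3 := ler_normD ((expR u - 1 - u) * sin v) ((1 + u) * (sin v - v)).
have b4 : 0 <= e * `|u| by rewrite mulr_ge0// ltW.
lra.
Qed.

(** By [circleM] the increment at x + iy is the one at 0 times a number of modulus exp x; hence the
    tolerance e / exp x. *)
Lemma cexp_diff x y (e : R) : 0 < e -> exists2 r : R, 0 < r & forall u v,
  `|u - x| < r -> `|v - y| < r ->
  modulus (circle (expR u) v - circle (expR x) y -
    circle (expR x) y * ((u - x) +i* (v - y))%C) <= e * (`|u - x| + `|v - y|).
Proof.
move=> e0; have k0 := expR_gt0 x.
have [r r0 hr] := cexp_diff0 (divr_gt0 e0 k0).
exists r => // u v ur vr.
have -> : circle (expR u) v = circle (expR x) y * circle (expR (u - x)) (v - y).
  by rewrite circleM -expRD !addrA ![_ + _ - _]addrAC !subrr !add0r.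
rewrite -{2}[circle (expR x) y]mulr1 -!mulrBr modulusM modulus_circle ?expR_ge0//.
have := hr _ _ ur vr; rewrite mulrAC ler_pdivlMr//; lra.
Qed.

Lemma comp_cexp_diff h z x y l : cdiff h (z + circle (expR x) y) l ->
  forall e : R, 0 < e -> exists2 r : R, 0 < r & forall u v,
  `|u - x| < r -> `|v - y| < r ->
  modulus (h (z + circle (expR u) v) - h (z + circle (expR x) y) -
    l * circle (expR x) y * ((u - x) +i* (v - y))%C) <= e * (`|u - x| + `|v - y|).
Proof.
move=> dh e e0; set E := circle (expR x) y.
have k0 := expR_gt0 x; have l0 := modulus_ge0 l.
have k1 : 0 < 1 + expR x by lra.
have l1 : 0 < modulus l + 1 by lra.
have e1 : 0 < e / 2 / (1 + expR x) by rewrite !divr_gt0.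
(* The 1 bounds the increment [n] by (1 + exp x) s; the other term makes l (n - E w) at most e / 2 *
   s. *)
have e2 : 0 < Num.min 1 (e / 2 / (modulus l + 1)).
  by rewrite lt_min ltr01 !divr_gt0.
have [r1 r10 h1] := dh _ e1; have [r2 r20 h2] := cexp_diff x y e2.
have r3 : 0 < r1 / (2 * (1 + expR x)) by rewrite divr_gt0// mulr_gt0.
exists (Num.min r2 (r1 / (2 * (1 + expR x)))); first by rewrite lt_min r20.
move=> u v; rewrite !lt_min => /andP[ur us] /andP[vr vs].
have {}h2 := h2 u v ur vr; rewrite -/E in h2.
set w : R[i] := ((u - x) +i* (v - y))%C in h2 *.
set s := `|u - x| + `|v - y| in h2 *.
have s0 : 0 <= s by rewrite addr_ge0.
have ws : modulus w <= s by apply: modulus_le_ReIm.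
set n := circle (expR u) v - E in h2 *.
have h21 : modulus (n - E * w) <= s.
  by apply: le_trans h2 _; rewrite ler_piMl// ge_min lexx.
have h22 : (modulus l + 1) * modulus (n - E * w) <= e / 2 * s.
  rewrite mulrC -ler_pdivlMr// mulrAC; apply: le_trans h2 _.
  by rewrite ler_wpM2r// ge_min lexx orbT.
have ns : modulus n <= (1 + expR x) * s.
  rewrite -[n](subrK (E * w)) mulrDl mul1r; apply: le_trans (modulusD _ _) _.
  by rewrite lerD// modulusM modulus_circle ?expR_ge0// ler_wpM2l ?expR_ge0.
have nr : modulus n < r1.
  apply: le_lt_trans ns _; move: us vs; rewrite !ltr_pdivlMr ?mulr_gt0// /s; lra.
have := h1 (z + circle (expR u) v).
have -> : z + circle (expR u) v - (z + E) = n by rewrite /n; ring.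
move=> /(_ nr) h3.
set A := h _ - h _ in h3 *.
have -> : A - l * E * w = (A - l * n) + l * (n - E * w) by ring.
apply: le_trans (modulusD _ _) _; rewrite modulusM.
have h4 : modulus (A - l * n) <= e / 2 * s.
  apply: le_trans h3 _; rewrite mulrAC ler_pdivrMr// -[leRHS]mulrA [s * _]mulrC.
  by rewrite ler_pM2l//; lra.
have := modulus_ge0 (n - E * w); lra.
Qed.

(** The Cauchy-Riemann equations for h(z + exp w), whose derivative is L: the y-derivative of the
    imaginary part and the x-derivative of the real part are both Re L, which is the [k] of
    [closed_on]. *)
Lemma fdiff_Re_Im h z x y l : cdiff h (z + circle (expR x) y) l ->
  let L := l * circle (expR x) y in
  fdiff (fun x y => complex.Im (h (z + circle (expR x) y))) x y
    (complex.Im L) (complex.Re L) /\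
  fdiff (fun x y => complex.Re (h (z + circle (expR x) y))) x y
    (complex.Re L) (- complex.Im L).
Proof.
move=> dh L; split=> e e0; have [r r0 hr] := comp_cexp_diff dh e0;
  exists r => // u v ur vr; apply: le_trans (hr u v ur vr).
- apply: le_trans (Im_le_modulus _); rewrite -/L; case: L (h _) (h _) => [a b] [c d] [c' d'] /=.
  by rewrite le_eqVlt; apply/orP; left; apply/eqP; congr `|_|; ring.
- apply: le_trans (Re_le_modulus _); rewrite -/L; case: L (h _) (h _) => [a b] [c d] [c' d'] /=.
  by rewrite le_eqVlt; apply/orP; left; apply/eqP; congr `|_|; ring.
Qed.

Section MeanValue.
Variables (h : R[i] -> R[i]) (z : R[i]) (r1 : R).
Hypothesis dh : forall w, 0 < modulus (w - z) < r1 -> derivable h w 1.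

Let U x y := complex.Re (h (z + circle (expR x) y)).

Let hclosed x y : expR x < r1 -> exists p k q,
  fdiff (fun x y => complex.Im (h (z + circle (expR x) y))) x y p k /\
  fdiff U x y k q.
Proof.
move=> xr; have := dh (w := z + circle (expR x) y).
rewrite addrAC subrr add0r modulus_circle ?expR_ge0// expR_gt0 xr => /(_ isT).
by move=> /derivable_cdiff/fdiff_Re_Im hd; do 3 eexists; exact: hd.
Qed.

Lemma circle_mean_cst (r s : R) : 0 < r -> r <= s -> s < r1 ->
  seg_int 0 (2 * pi) (fun t => complex.Re (h (z + circle r t))) =
  seg_int 0 (2 * pi) (fun t => complex.Re (h (z + circle s t))).
Proof.
move=> r0 rs sr1; have s0 : 0 < s by lra.
have pi0 : 0 <= 2 * pi :> R by rewrite mulr_ge0// pi_ge0.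
have C : closed_on (fun x y => complex.Im (h (z + circle (expR x) y))) U (ln r) (ln s) 0 (2 * pi).
  move=> x y /andP[_ xs] _; apply: hclosed.
  by apply: le_lt_trans sr1; rewrite -[leRHS]lnK// ler_expR.
have lrs : ln r <= ln s by rewrite ler_ln.
have := goursat lrs pi0 C; rewrite (circulationE lrs pi0 C).
rewrite (@eq_seg_int _ _ _ _ (fun x => complex.Im (h (z + circle (expR x) (2 * pi))))); last first.
  by move=> x _ /=; rewrite circle_2pi.
by rewrite subrr add0r => /eqP; rewrite subr_eq0 => /eqP; rewrite /U !lnK.
Qed.

Lemma circle_Re_continuous (r : R) t : 0 < r < r1 ->
  {for t, continuous (fun t => complex.Re (h (z + circle r t)))}.
Proof.
move=> /andP[r0 rr1]; have := @hclosed (ln r) t; rewrite /U !lnK// => /(_ rr1).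
move=> [p [k [q [_ /fdiff_continuous2]]]].
by rewrite /prop_for /continuous_at lnK.
Qed.

(** The mean does not depend on the radius, and over small circles it tends to Re m. The centre
    enters only through the limit [m], so h may be a difference quotient at z. *)
Lemma circle_mean_value (r : R) m : 0 < r -> r < r1 ->
  (forall e : R, 0 < e -> exists2 s : R, 0 < s &
    forall w, 0 < modulus (w - z) < s -> modulus (h w - m) < e) ->
  seg_int 0 (2 * pi) (fun t => complex.Re (h (z + circle r t))) =
  2 * pi * complex.Re m.
Proof.
move=> r0 rr1 ch; apply/eqP; rewrite -subr_eq0 -normr_le0; apply/ler_addgt0Pl => e e0.
have pi0 := pi_gt0 R; have e1 : 0 < e / (2 * pi) by rewrite divr_gt0// mulr_gt0.
have [s s0 hs] := ch _ e1.
pose t := Num.min r (s / 2).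
have [t0 tr ts] : [/\ 0 < t, t <= r & t < s].
  split; first by rewrite lt_min r0 divr_gt0.
    by rewrite ge_min lexx.
  by rewrite gt_min; apply/orP; right; lra.
rewrite -(circle_mean_cst t0 tr rr1).
have := @seg_int_bound R 0 (2 * pi) (fun x => complex.Re (h (z + circle t x))) (complex.Re m) (e
  / (2 * pi)).
rewrite subr0 divfK ?mulf_neq0 ?gt_eqF// [_ * (2 * pi)]mulrC addr0; apply; first lra.
  by move=> x _; apply: circle_Re_continuous; lra.
move=> x _; rewrite -raddfB; apply: le_trans (Re_le_modulus _) _.
by apply/ltW/hs; rewrite addrAC subrr add0r modulus_circle ?t0// ltW.
Qed.

End MeanValue.

End ComplexExponential.

(** * Openness and continuity of the derivative *)

Section OpenMapping.
Context {R : realType}.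
Implicit Types (z w m c : R[i]) (f : R[i] -> R[i]) (r s t e : R).

Lemma circle_continuous r t e : 0 < e -> \forall s \near t,
  modulus (circle r s - circle r t) < e.
Proof.
move=> e0; have e2 : 0 < e / 2 by rewrite divr_gt0.
have H (g : R -> R) : continuous g -> \forall s \near t, `|r * g t - r * g s| < e / 2.
  move=> cg; have : r * g s @[s --> t] --> r * g t.
    by apply: cvgM; [exact: cvg_cst|exact: cg].
  by move/cvgrPdist_lt; apply.
have H1 := H _ (@continuous_cos R); have H2 := H _ (@continuous_sin R).
near=> s; apply: le_lt_trans (modulus_le_ReIm _) _ => /=.
rewrite distrC [X in _ + X]distrC; rewrite [e]splitr; apply: ltrD.
  by near: s.
by near: s.
Unshelve. all: by end_near. Qed.

Lemma ccont_near f z : ccont f z <->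
  forall e, 0 < e -> \forall w \near z, modulus (f w - f z) < e.
Proof.
by split=> h e e0; [apply/nbhs_modulusP|apply/nbhs_modulusP]; exact: h.
Qed.

Lemma ccont_circle0 f r t : ccont f (circle r t) ->
  {for t, continuous (fun s => modulus (f (circle r s)))}.
Proof.
move=> cf; apply/cvgrPdist_lt => e e0; have [d d0 hd] := cf e e0.
have := circle_continuous r t d0; apply: filterS => s /hd.
apply: le_lt_trans; rewrite ler_norml.
have := modulus_tri (f (circle r t)) (f (circle r s)) 0.
have := modulus_tri (f (circle r s)) (f (circle r t)) 0.
by rewrite !subr0 (modulusB (f (circle r s)) (f (circle r t))); lra.
Qed.

Lemma ccont_circle f z r t : ccont f (z + circle r t) ->
  {for t, continuous (fun s => modulus (f (z + circle r s)))}.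
Proof.
move=> cf; apply: (@ccont_circle0 (fun w => f (z + w))) => e e0.
have [d d0 hd] := cf e e0; exists d => // w wd; apply: hd.
by rewrite opprD addrACA subrr add0r.
Qed.

(* Comparison of 1 / (f - w) at the centre of a circle, where it would be
   large, with its mean over the circle. *)
Lemma open_mapping_at f z r1 r : 0 < r -> r < r1 ->
  (forall w, modulus (w - z) < r1 -> derivable f w 1) ->
  (forall t, f (z + circle r t) != f z) ->
  \forall w \near f z, exists2 x, modulus (x - z) < r1 & f x = w.
Proof.
move=> r0 rr1 df fz.
have pi0 : 0 < 2 * pi :> R by rewrite mulr_gt0// pi_gt0.
have [t0 _ ht0] : exists2 c : R, c \in `[0, 2 * pi] & forall t, t \in `[0, 2 * pi] ->
    modulus (f (z + circle r c) - f z) <= modulus (f (z + circle r t) - f z).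
  apply: EVT_min; first exact: ltW.
  apply: continuous_in_subspaceT => t _.
  apply: (@ccont_circle (fun x => f x - f z)) => e e0.
  have [|d d0 hd] := derivable_ccont (df (z + circle r t) _) e0.
    by rewrite addrAC subrr add0r modulus_circle// ltW.
  by exists d => // w /hd; congr (modulus _ < _); ring.
pose mm := modulus (f (z + circle r t0) - f z).
have m0 : 0 < mm by rewrite modulus_gt0 subr_eq0.
have d0 : 0 < mm / 2 by rewrite divr_gt0.
apply/nbhs_modulusP; exists (mm / 2) => // w wd; apply: contrapT => nex.
have fw x : modulus (x - z) < r1 -> f x - w != 0.
  by move=> xz; rewrite subr_eq0; apply/eqP => xw; apply: nex; exists x.
have fz0 : f z - w != 0 by apply: fw; rewrite subrr modulus0; lra.
(* The rotation [c] makes [h z] the positive number 1 / |f z - w|, so comparing real parts is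
   enough. On the circle |f - w| > mm / 2, whereas |f z - w| < mm / 2. *)
pose c : R[i] := (modulus (f z - w)^-1)%:C%C * (f z - w).
pose h x := c * (f x - w)^-1.
have c1 : modulus c = 1.
  rewrite modulusM modulus_real ger0_norm ?modulus_ge0// modulusV mulVf//.
  by rewrite modulus_eq0.
have dh x : modulus (x - z) < r1 -> derivable h x 1.
  move=> xz; apply: derivableM; first exact: derivable_cst.
  apply: derivableV; first exact: fw.
  by apply: derivableB; [exact: df|exact: derivable_cst].
have hz : h z = (modulus (f z - w)^-1)%:C%C by rewrite /h /c mulfK.
have hd x : 0 < modulus (x - z) < r1 -> derivable h x 1 by move=> /andP[_]; exact: dh.
have hc e : 0 < e -> exists2 s : R, 0 < s &
    forall x, 0 < modulus (x - z) < s -> modulus (h x - h z) < e.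
  move=> e0; have [|s s0 hs] := derivable_ccont (dh z _) e0.
    by rewrite subrr modulus0; lra.
  by exists s => // x /andP[_ /hs].
have E := circle_mean_value hd r0 rr1 hc; rewrite hz /= in E.
have : seg_int 0 (2 * pi) (fun t => complex.Re (h (z + circle r t))) <=
    seg_int 0 (2 * pi) (fun=> (mm / 2)^-1).
  apply: le_seg_int.
  - by move=> t _; apply: (circle_Re_continuous hd); rewrite r0.
  - by move=> t _; exact: cvg_cst.
  move=> t ht; apply: le_trans (ler_norm _) _; apply: le_trans (Re_le_modulus _) _.
  rewrite /h modulusM c1 mul1r modulusV lef_pV2 ?posrE//; last first.
    by rewrite modulus_gt0 fw// addrAC subrr add0r modulus_circle// ltW.
  have := ht0 t; rewrite in_itv/= => /(_ ht); rewrite -/mm => h1.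
  have := modulus_tri w (f (z + circle r t)) (f z); lra.
rewrite E seg_int_cst ?subr0; last exact: ltW.
rewrite [leRHS]mulrC ler_pM2l// modulusV lef_pV2 ?posrE//; last by rewrite modulus_gt0.
by rewrite (modulusB _ w) leNgt wd.
Qed.

(** The number f'(x) is the mean of (f w - f x) / (w - x) over |w - x| = d. For x = z and x = z'
    these quotients are uniformly close, because f is uniformly close on the two circles. *)
Lemma derive1_ccont f z r1 : 0 < r1 ->
  (forall w, modulus (w - z) < r1 -> derivable f w 1) -> ccont (derive1 f) z.
Proof.
move=> r10 df; apply/ccont_near => e e0.
have pi0 : 0 < 2 * pi :> R by rewrite mulr_gt0// pi_gt0.
(* With centres within [d] of z, the disks of radius 2 d on which the quotients are differentiable
   stay within r1 of z. *)
pose d := r1 / 3; have d0 : 0 < d by rewrite divr_gt0.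
(* Two errors e d / 16 make e d / 8 on the circle; the centre adds e d / 8. Dividing by d leaves e /
   4 for each of the real and imaginary parts. *)
have e1 : 0 < e * d / 16 by rewrite divr_gt0// mulr_gt0.
have cf w : modulus (w - z) < r1 -> ccont f w by move/df/derivable_ccont.
have zd : \forall z' \near z, modulus (z' - z) < d.
  by apply/nbhs_modulusP; exists d.
pose Q (z' : R[i]) (t : R) :=
  modulus (f (z' + circle d t) - f (z + circle d t)) < e * d / 8.
have U : \forall z' \near z, `[0, 2 * pi] `<=` Q z'.
  (* Compactness of the parameter interval gives one neighbourhood of z that works for all t. *)
  have /compact_near_coveringP K := @segment_compact R 0 (2 * pi).
  apply: (K _ (nbhs z) Q) => t _; have [|s s0 hs] := cf (z + circle d t) _ _ e1.
    by rewrite addrAC subrr add0r modulus_circle ?(ltW d0)// /d; lra.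
  have s2 : 0 < s / 2 by rewrite divr_gt0.
  exists ([set t' | modulus (circle d t' - circle d t) < s / 2],
          [set z' | modulus (z' - z) < s / 2]) => /=.
    by split; [exact: circle_continuous|apply/nbhs_modulusP; exists (s / 2)].
  move=> [t' z'] /= [ht' hz'].
  have h1 := hs (z' + circle d t'); have h2 := hs (z + circle d t').
  have k1 : modulus (z' + circle d t' - (z + circle d t)) < s.
    rewrite opprD addrACA; apply: le_lt_trans (modulusD _ _) _; lra.
  have k2 : modulus (z + circle d t' - (z + circle d t)) < s.
    by rewrite opprD addrACA subrr add0r; lra.
  have := modulus_tri (f (z + circle d t)) (f (z' + circle d t')) (f (z + circle d t')).
  have := h1 k1; have := h2 k2.
  by rewrite (modulusB (f (z + circle d t'))) /Q/=; lra.
have V : \forall z' \near z, modulus (f z' - f z) < e * d / 8.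
  have : modulus (z - z) < r1 by rewrite subrr modulus0.
  by move=> /cf/ccont_near; apply; lra.
near=> z'.
have zz : modulus (z' - z) < d by near: z'.
have Uz t : 0 <= t <= 2 * pi -> modulus (f (z' + circle d t) - f (z + circle d t)) < e * d / 8.
  move=> ht; suff : `[0, 2 * pi] `<=` Q z' by apply; rewrite /= in_itv.
  by near: z'.
have Vz : modulus (f z' - f z) < e * d / 8 by near: z'.
have M (c x : R[i]) : modulus (x - z) < d ->
    seg_continuous 0 (2 * pi) (fun t => complex.Re (c * ((f (x + circle d t) - f x) / circle d
      t))) /\
    seg_int 0 (2 * pi) (fun t => complex.Re (c * ((f (x + circle d t) - f x) / circle d t))) =
    2 * pi * complex.Re (c * derive1 f x).
  move=> xd; pose q w := c * ((f w - f x) / (w - x)).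
  have dfx w : modulus (w - x) < 2 * d -> derivable f w 1.
    move=> wx; apply: df; apply: le_lt_trans (modulus_tri x _ _) _.
    by move: wx xd; rewrite /d; lra.
  have dq w : 0 < modulus (w - x) < 2 * d -> derivable q w 1.
    move=> /andP[w0 wx]; apply: derivableM; first exact: derivable_cst.
    apply: derivableM.
      by apply: derivableB; [exact: dfx|exact: derivable_cst].
    apply: derivableV; first by rewrite -modulus_gt0.
    by apply: derivableB; [exact: derivable_id|exact: derivable_cst].
  have eq_q t : q (x + circle d t) = c * ((f (x + circle d t) - f x) / circle d t).
    by rewrite /q; congr (_ * (_ / _)); ring.
  have d2 : d < 2 * d by lra.
  have eqf : (fun t => complex.Re (c * ((f (x + circle d t) - f x) / circle d t))) =
     fun t => complex.Re (q (x + circle d t)) by apply/funext => t; rewrite eq_q.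
  rewrite eqf; split; first by move=> t _; apply: (circle_Re_continuous dq); rewrite d0.
  apply: (circle_mean_value dq d0 d2) => e' e'0.
  have k0 : 0 < e' / (modulus c + 1) by rewrite divr_gt0// ltr_wpDl ?modulus_ge0.
  have [|s s0 hs] := derivable_cdiff (dfx x _) k0; first by rewrite subrr modulus0; lra.
  exists s => // w /andP[w0 ws]; have wx0 : w - x != 0 by rewrite -modulus_gt0.
  rewrite /q -mulrBr.
  have -> : (f w - f x) / (w - x) - derive1 f x = (f w - f x - derive1 f x * (w - x)) / (w - x)
    by field.
  rewrite modulusM [X in _ * X]modulusM.
  have := hs w ws; rewrite -ler_pdivrMr// -modulusV => h1.
  have c0 := modulus_ge0 c.
  apply: le_lt_trans (ler_wpM2l c0 h1) _.
  by rewrite mulrCA gtr_pMr// ltr_pdivrMr; lra.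
have B (c : R[i]) : modulus c = 1 -> `|complex.Re (c * (derive1 f z' - derive1 f z))| <= e / 4.
  move=> c1; have [C1 E1] := M c z' zz; have zz0 : modulus (z - z) < d by rewrite subrr modulus0.
  have [C2 E2] := M c z zz0.
  rewrite mulrBr raddfB; apply: (seg_mean_dist pi0 C1 C2 E1 E2).
  move=> t ht; rewrite -raddfB -mulrBr; apply: le_trans (Re_le_modulus _) _.
  rewrite modulusM c1 mul1r -mulrBl modulusM modulusV modulus_circle ?(ltW d0)//.
  rewrite ler_pdivrMr//.
  have -> : f (z' + circle d t) - f z' - (f (z + circle d t) - f z) =
    (f (z' + circle d t) - f (z + circle d t)) + - (f z' - f z) by ring.
  apply: le_trans (modulusD _ _) _; rewrite modulusN.
  by move: (Uz t ht) Vz; clear; lra.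
set D := derive1 f z' - derive1 f z in B *.
(* Multiplication by -i turns the imaginary part of [D] into a real part. *)
have k1 : modulus (0 +i* (-1) : R[i])%C = 1.
  by rewrite modulus_def sqrrN expr0n expr1n add0r sqrtr1.
have h1 := B 1 modulus1; have h2 := B _ k1.
apply: le_lt_trans (modulus_le_ReIm _) _; move: h1 h2; rewrite mul1r; clear -e0;
  case: (D) => x y /=.
rewrite mul0r mulN1r sub0r opprK; lra.
Unshelve. all: by end_near. Qed.

End OpenMapping.

(** * Arc length of the image of a circle *)

Section Arclength.
Context {R : realType}.
Implicit Types (r s t x : R) (f : R[i] -> R[i]) (h F : R -> R).

Lemma seg_int_derive h a x : continuous h -> a < x ->
  is_derive x 1 (fun t => seg_int a t h) (h x).
Proof.
move=> ch ax; have x1 : x < x + 1 by lra.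
have [d e] := @continuous_FTC1_closed R h a x (x + 1) x1
  (seg_integrable (fun y _ => ch y)) ax (ch x).
by split; [exact: d|rewrite -derive1E -e].
Qed.

Lemma le_variation_seg_int F F' h s t : continuous h ->
  (forall x, is_derive x 1 F (F' x)) -> (forall x, `|F' x| <= h x) ->
  s <= t -> `|F t - F s| <= seg_int s t h.
Proof.
(* Starting the primitive at s - 1 makes it differentiable at s as well. *)
move=> ch dF Fh st; pose G x := seg_int (s - 1) x h.
have dG x : s <= x -> is_derive x 1 G (h x).
  by move=> sx; apply: seg_int_derive => //; lra.
have s1 : s - 1 <= s by lra.
have Gst : seg_int s t h = G t - G s.
  rewrite /G (seg_int_split s1 st (fun y _ => ch y)); ring.
(* The cases c = 1 and c = -1 are the two halves of the absolute value. *)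
have key c : c ^+ 2 = 1 -> c * (F t - F s) <= G t - G s.
  move=> c2; have d x : s <= x -> is_derive x 1 (fun x => G x - c * F x) (h x - c * F' x).
    by move=> /dG gx; apply: is_deriveB.
  have [| |x xst] := @MVT_segment R (fun x => G x - c * F x) (fun x => h x - c * F' x) s t st.
  - by move=> x; rewrite in_itv/= => /andP[/ltW sx _]; exact: d.
  - apply: continuous_in_subspaceT => x; rewrite inE/= in_itv/= => /andP[sx _].
    by apply: differentiable_continuous; apply/derivable1_diffP; have [] := d x sx.
  move=> E; suff : 0 <= (h x - c * F' x) * (t - s) by rewrite -E; lra.
  rewrite mulr_ge0 ?subr_ge0//; apply: le_trans (Fh x).
  apply: le_trans (ler_norm _) _; rewrite normrM.
  have -> : `|c| = 1; last by rewrite mul1r.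
  by apply/eqP; rewrite -(@eqrXn2 _ 2)// expr1n real_normK ?num_real// c2.
rewrite Gst ler_norml; have := key 1; have := key (-1).
by rewrite sqrrN expr1n => /(_ erefl) + /(_ erefl); lra.
Qed.

Lemma fdiff_derive2 P x y p q : fdiff P x y p q -> is_derive y 1 (P x) (q : R).
Proof.
move=> hP.
have cv : (fun h : R => h^-1 *: (P x (h *: 1 + y) - P x y)) @ 0^' --> q.
  apply/cvgrPdist_le => e e0; have [r r0 hr] := hP e e0.
  apply/nbhs_ballP; exists r => // k; rewrite /ball/= sub0r normrN => kr k0.
  have := hr x (k + y); rewrite subrr normr0 addrK => /(_ r0 kr).
  rewrite mulr0 subr0 add0r -[k *: 1]/(k * 1) mulr1 => hk.
  have -> : q - k^-1 *: (P x (k + y) - P x y) = - (P x (k + y) - P x y - q * k) / k.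
    by rewrite -[_ *: _]/(_ * _); field.
  by rewrite normrM normrN normfV ler_pdivrMr ?normr_gt0.
by split; [apply/cvg_ex; exists q|exact: cvg_lim cv].
Qed.

(** The first coordinate of [stereo]; its second coordinate is [stereo_x] with the arguments
    exchanged. *)
Definition stereo_x (a b : R) := 2 * a / (1 + a ^+ 2 + b ^+ 2).
Definition stereo_z (a b : R) := (a ^+ 2 + b ^+ 2 - 1) / (1 + a ^+ 2 + b ^+ 2).

Lemma stereo_den_gt0 (a b : R) : 0 < 1 + a ^+ 2 + b ^+ 2.
Proof. by rewrite -addrA ltr_pwDl// addr_ge0// sqr_ge0. Qed.

Lemma is_derive_quotient (u v : R -> R) t u' v' : v t != 0 ->
  is_derive t 1 u u' -> is_derive t 1 v v' ->
  is_derive t 1 (fun t => u t / v t) ((u' * v t - u t * v') / v t ^+ 2).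
Proof.
move=> v0 du dv.
have dV : is_derive t 1 (fun t => (v t)^-1) (- (v t) ^- 2 * v').
  split; first by apply: derivableV => //; exact: ex_derive.
  by rewrite deriveV ?derive_val//; exact: ex_derive.
have -> : (u' * v t - u t * v') / v t ^+ 2 =
  u t *: (- v t ^- 2 * v') + (v t)^-1 *: u'.
  by rewrite -![_ *: _]/(_ * _); field.
exact: is_deriveM.
Qed.

(** With N / D^2 from the quotient rule, this reduces a speed bound to a polynomial inequality
    without roots. *)
Lemma ler_quotient_sqrt (N S D : R) : 0 < D -> 0 <= S ->
  N ^+ 2 <= 4 * S * D ^+ 2 -> `|N / D ^+ 2| <= 2 * Num.sqrt S / D.
Proof.
move=> D0 S0 NS; have D20 : 0 < D ^+ 2 by rewrite exprn_gt0.
rewrite normrM normfV (gtr0_norm D20) ler_pdivrMr// -[D ^+ 2]/(D * D) mulrA.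
rewrite divfK ?gt_eqF// -(ler_pXn2r (_ : 0 < 2)%N) ?nnegrE//; last first.
  by rewrite !mulr_ge0 ?sqrtr_ge0// ltW.
by rewrite real_normK ?num_real// !exprMn sqr_sqrtr//; lra.
Qed.

(** Inverse stereographic projection stretches lengths by 2 / (1 + |z|^2) in every direction, and
    one coordinate moves no faster than the point. After squaring, the gap in the inequality is a
    sum of nonnegative terms. *)
Lemma stereo_x_derive (a b : R -> R) t a' b' :
  is_derive t 1 a a' -> is_derive t 1 b b' ->
  exists2 d, is_derive t 1 (fun t => stereo_x (a t) (b t)) d &
    `|d| <= 2 * Num.sqrt (a' ^+ 2 + b' ^+ 2) / (1 + a t ^+ 2 + b t ^+ 2).
Proof.
move=> da db; have D0 := stereo_den_gt0 (a t) (b t); have Dn := lt0r_neq0 D0.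
have dD : is_derive t 1 (fun t => 1 + a t ^+ 2 + b t ^+ 2) (2 * a t * a' + 2 * b t * b').
  by apply: is_derive_eq; rewrite add0r -![_ *: _]/(_ * _); ring.
have dN : is_derive t 1 (fun t => 2 * a t) (2 * a').
  by apply: is_derive_eq; rewrite -![_ *: _]/(_ * _); ring.
eexists; first exact: (@is_derive_quotient _ (fun t => 1 + a t ^+ 2 + b t ^+ 2) _ _ _ Dn dN dD).
apply: ler_quotient_sqrt => //; first by rewrite addr_ge0 ?sqr_ge0.
set A := a t; set B := b t; rewrite -subr_ge0.
have -> : 4 * (a' ^+ 2 + b' ^+ 2) * (1 + A ^+ 2 + B ^+ 2) ^+ 2 -
    (2 * a' * (1 + A ^+ 2 + B ^+ 2) - 2 * A * (2 * A * a' + 2 * B * b')) ^+ 2 =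
  4 * (a' * (2 * A * B) + b' * (1 - A ^+ 2 + B ^+ 2)) ^+ 2 +
  16 * A ^+ 2 * (a' ^+ 2 + b' ^+ 2) by ring.
by repeat first [exact: sqr_ge0|exact: ler0n|apply: addr_ge0|apply: mulr_ge0].
Qed.

Lemma stereo_z_derive (a b : R -> R) t a' b' :
  is_derive t 1 a a' -> is_derive t 1 b b' ->
  exists2 d, is_derive t 1 (fun t => stereo_z (a t) (b t)) d &
    `|d| <= 2 * Num.sqrt (a' ^+ 2 + b' ^+ 2) / (1 + a t ^+ 2 + b t ^+ 2).
Proof.
move=> da db; have D0 := stereo_den_gt0 (a t) (b t); have Dn := lt0r_neq0 D0.
have dD : is_derive t 1 (fun t => 1 + a t ^+ 2 + b t ^+ 2) (2 * a t * a' + 2 * b t * b').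
  by apply: is_derive_eq; rewrite add0r -![_ *: _]/(_ * _); ring.
have dN : is_derive t 1 (fun t => a t ^+ 2 + b t ^+ 2 - 1) (2 * a t * a' + 2 * b t * b').
  by apply: is_derive_eq; rewrite oppr0 addr0 -![_ *: _]/(_ * _); ring.
eexists; first exact: (@is_derive_quotient _ (fun t => 1 + a t ^+ 2 + b t ^+ 2) _ _ _ Dn dN dD).
apply: ler_quotient_sqrt => //; first by rewrite addr_ge0 ?sqr_ge0.
set A := a t; set B := b t; rewrite -subr_ge0.
set D' := 2 * A * a' + 2 * B * b'.
have -> : 4 * (a' ^+ 2 + b' ^+ 2) * (1 + A ^+ 2 + B ^+ 2) ^+ 2 -
    (D' * (1 + A ^+ 2 + B ^+ 2) - (A ^+ 2 + B ^+ 2 - 1) * D') ^+ 2 =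
  4 * (a' ^+ 2 + b' ^+ 2) * (1 - A ^+ 2 - B ^+ 2) ^+ 2 +
  16 * (A * b' - B * a') ^+ 2 by rewrite /D'; ring.
by repeat first [exact: sqr_ge0|exact: ler0n|apply: addr_ge0|apply: mulr_ge0].
Qed.

(** The maximum distance in R^3: a Lipschitz bound for it is three bounds for real functions.
    [sup_dist_ball] leads back to the spherical metric. *)
Definition sup_dist (u v : R * R * R) :=
  Num.max (Num.max `|u.1.1 - v.1.1| `|u.1.2 - v.1.2|) `|u.2 - v.2|.

Lemma sup_distC u v : sup_dist u v = sup_dist v u.
Proof.
case: u v => [[u1 u2] u3] [[v1 v2] v3]; rewrite /sup_dist /=.
by rewrite (distrC u1) (distrC u2) (distrC u3).
Qed.

Lemma sup_dist_eq0 u v : sup_dist u v <= 0 -> u = v.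
Proof.
case: u v => [[u1 u2] u3] [[v1 v2] v3]; rewrite /sup_dist /=.
rewrite !ge_max !normr_le0 !subr_eq0.
by move=> /andP[/andP[/eqP-> /eqP->] /eqP->].
Qed.

Section Curve.
Variables (f : R[i] -> R[i]) (r : R).
Hypothesis df : holomorphic (disk 1) f.
Hypothesis r01 : 0 < r < 1.

(** The factor 2 is there because lengths are measured on the unit sphere of R^3. *)
Let speed t := 2 * (spherical_derivative f (circle r t) * r).

Let circle_disk t : disk 1 (circle r t).
Proof. by case/andP: r01 => r0 r1; rewrite /disk/= modulus_circle// ltW. Qed.

Lemma spherical_derivative_circle_continuous :
  continuous (fun t => spherical_derivative f (circle r t) * r).
Proof.
move=> t; rewrite /spherical_derivative.
have d1 : 0 < 1 - r by case/andP: r01 => _; rewrite subr_gt0.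
have c1 : {for t, continuous (fun s => modulus (derive1 f (circle r s)))}.
  apply: ccont_circle0; apply: (derive1_ccont d1) => w wr; apply: df.
  rewrite /disk/= -[w](subrK (circle r t)); apply: le_lt_trans (modulusD _ _) _.
  by case/andP: r01 => r0 r1; rewrite modulus_circle ?(ltW r0)//; lra.
have c2 : {for t, continuous (fun s => modulus (f (circle r s)))}.
  by apply: ccont_circle0; apply/derivable_ccont/df.
apply: cvgM; last exact: cvg_cst.
apply: cvgM => //; apply: cvgV.
  by rewrite gt_eqF// ltr_pwDl// sqr_ge0.
by apply: cvgD; [exact: cvg_cst|exact: cvgM].
Qed.

Let speed_continuous : continuous speed.
Proof.
move=> t; apply: cvgM; first exact: cvg_cst.
exact: spherical_derivative_circle_continuous.
Qed.

(** Since circle r t = exp(ln r + it), the y-derivatives of [fdiff_Re_Im] at z = 0, x = ln r are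
    derivatives along the circle. They are the two parts of a number of modulus r |f'|, up to a
    sign. *)
Let curve_derive t : exists a' b',
  [/\ is_derive t 1 (fun t => complex.Re (f (circle r t))) a',
      is_derive t 1 (fun t => complex.Im (f (circle r t))) b' &
      2 * Num.sqrt (a' ^+ 2 + b' ^+ 2) /
        (1 + complex.Re (f (circle r t)) ^+ 2 + complex.Im (f (circle r t)) ^+ 2)
      = speed t].
Proof.
have /andP[r0 r1] := r01.
have := df (circle_disk t); rewrite -{1}[circle r t]add0r -{1}[r]lnK//.
move=> /derivable_cdiff/fdiff_Re_Im [/fdiff_derive2 d2 /fdiff_derive2 d1].
move: d1 d2; rewrite !add0r lnK//.
under eq_fun do rewrite add0r.
move=> d1; under eq_fun do rewrite add0r.
move=> d2; do 2 eexists; split; [exact: d1|exact: d2|].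
rewrite sqrrN addrC -sqr_modulus sqrtr_sqr ger0_norm ?modulus_ge0//.
rewrite modulusM modulus_circle ?(ltW r0)// -addrA -sqr_modulus /speed.
by rewrite /spherical_derivative; ring.
Qed.

Lemma le_stereo_seg_int s t : s <= t ->
  sup_dist (stereo (Some (f (circle r t)))) (stereo (Some (f (circle r s))))
    <= seg_int s t speed.
Proof.
move=> st.
have stereoE z : stereo (Some z : riemann_sphere R) =
   (stereo_x (complex.Re z) (complex.Im z), stereo_x (complex.Im z) (complex.Re z),
    stereo_z (complex.Re z) (complex.Im z)).
  by case: z => x y /=; rewrite /stereo_x [1 + y ^+ 2 + _]addrAC.
have key (X : R -> R -> R) (HX : forall (a b : R -> R) t a' b',
  is_derive t 1 a a' -> is_derive t 1 b b' ->
  exists2 d, is_derive t 1 (fun t => X (a t) (b t)) d &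
    `|d| <= 2 * Num.sqrt (a' ^+ 2 + b' ^+ 2) / (1 + a t ^+ 2 + b t ^+ 2)) :
  `|X (complex.Re (f (circle r t))) (complex.Im (f (circle r t))) -
    X (complex.Re (f (circle r s))) (complex.Im (f (circle r s)))|
    <= seg_int s t speed.
  have /choice[d Hd] x : exists d, is_derive x 1
      (fun t => X (complex.Re (f (circle r t))) (complex.Im (f (circle r t)))) d /\
      `|d| <= speed x.
    have [a' [b' [da db <-]]] := curve_derive x.
    by have [d dd hd] := HX _ _ _ _ _ da db; exists d.
  exact: (@le_variation_seg_int (fun t => X (complex.Re (f (circle r t)))
    (complex.Im (f (circle r t)))) d speed s t speed_continuous
    (fun x => (Hd x).1) (fun x => (Hd x).2) st).
have kx := key stereo_x stereo_x_derive.
have kz := key stereo_z stereo_z_derive.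
have ky := key (fun a b => stereo_x b a).
rewrite !stereoE /sup_dist /= !ge_max kx kz andbT; apply: ky.
move=> a b x a' b' da db.
have [d dd hd] := stereo_x_derive db da; exists d => //.
by rewrite [a' ^+ 2 + _]addrC addrAC.
Qed.

(* [sigma s] is the parameter up to which the arc has length [s], with [s]
   clamped to the range of that length. *)
Lemma arclength_parametrization (L : R) : seg_int 0 (2 * pi) speed <= L ->
  exists sigma : R -> R,
    (forall s t, sup_dist (stereo (Some (f (circle r (sigma t)))))
       (stereo (Some (f (circle r (sigma s))))) <= `|t - s|) /\
    (forall t, 0 <= t <= 2 * pi -> exists2 s, 0 <= s <= L &
       f (circle r (sigma s)) = f (circle r t)).
Proof.
have : 0 <= 2 * pi :> R by rewrite mulr_ge0// pi_ge0.
move: (2 * pi) => p p0 pL.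
(* Arc length from the parameter 0, written with base point -1 so that it is differentiable at 0
   too. *)
pose G t := seg_int (-1) t speed - seg_int (-1) 0 speed.
have GE s t : -1 <= s -> s <= t -> seg_int s t speed = G t - G s.
  move=> s0 st; have := seg_int_split s0 st (fun y _ => @speed_continuous y).
  by move=> e; rewrite /G e; ring.
have cG : {within `[0, p], continuous G}.
  apply: continuous_in_subspaceT => x; rewrite inE/= in_itv/= => /andP[x0 _].
  apply: cvgB; last exact: cvg_cst.
  apply: differentiable_continuous; apply/derivable1_diffP.
  have x1 : -1 < x by lra.
  by have [] := seg_int_derive speed_continuous x1.
have G0 : G 0 = 0 by rewrite /G subrr.
have G0E t : 0 <= t -> G t = seg_int 0 t speed.
  by move=> t0; rewrite GE ?G0 ?subr0// lerN10.
have Gp : 0 <= G p.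
  rewrite G0E//.
  apply: Rintegral_ge0 => x _; rewrite /speed !mulr_ge0 ?modulus_ge0 ?invr_ge0//.
    by rewrite addr_ge0 ?sqr_ge0.
  by case/andP: r01 => /ltW.
have Gmono s t : 0 <= s -> s <= t -> 0 <= G t - G s.
  move=> s0 st; rewrite -GE//; last by rewrite (le_trans _ s0)// lerN10.
  apply: le_trans (le_stereo_seg_int st).
  by rewrite /sup_dist !le_max normr_ge0.
pose clamp s := Num.min (Num.max 0 s) (G p).
have clampP s : 0 <= clamp s <= G p.
  by rewrite /clamp le_min Gp le_max lexx ge_min lexx orbT.
have /choice[sigma Hs] s : exists t, 0 <= t <= p /\ G t = clamp s.
  have [|t] := @IVT R G 0 p (clamp s) p0 cG.
    by rewrite G0 (min_idPl Gp) (max_idPr Gp) clampP.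
  by rewrite in_itv/= => t0 Gt; exists t.
have dist s t : 0 <= s -> 0 <= t ->
    sup_dist (stereo (Some (f (circle r t)))) (stereo (Some (f (circle r s))))
    <= `|G t - G s|.
  wlog st : s t / s <= t => [hw|] s0 t0.
    have [st|/ltW ts] := leP s t; first exact: hw.
    by rewrite sup_distC distrC; exact: hw.
  apply: le_trans (le_stereo_seg_int st) _.
  by rewrite GE ?ler_norm// (le_trans _ s0)// lerN10.
exists sigma; split=> [s t|t /andP[t0 tp]].
  have [/andP[s0 _] es] := Hs s; have [/andP[t0 _] et] := Hs t.
  apply: le_trans (dist _ _ s0 t0) _; rewrite es et /clamp.
  have h1 := ler_norm (t - s); have h2 := ler_norm (s - t).
  rewrite distrC in h2; move: h1 h2 Gp; rewrite ler_norml; clear.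
  by case: (leP 0 t) => ?; case: (leP 0 s) => ?; case: (leP t (G p)) => ?;
    case: (leP s (G p)) => ?; case: (leP 0 (G p)) => ? *; lra.
have Gt0 : 0 <= G t by have := Gmono _ _ (lexx 0) t0; rewrite G0 subr0.
have Gtp : G t <= G p by rewrite -subr_ge0 Gmono.
exists (G t).
  rewrite Gt0 (le_trans Gtp)//; apply: le_trans pL.
  by rewrite G0E.
(* The parameter [sigma (G t)] may differ from [t], but the arc between them has length 0, so f
   takes the same value at both. *)
have [/andP[s0 _] es] := Hs (G t).
have := dist _ _ t0 s0; rewrite es /clamp (max_idPr Gt0) (min_idPl Gtp).
by rewrite subrr normr0 => /sup_dist_eq0/stereo_inj[].
Qed.

End Curve.
End Arclength.

(** * The topology of the sphere *)

Section SphereTopology.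
Context {R : realType}.
Implicit Types (p q : riemann_sphere R) (z w : R[i]) (e d : R).

(** Half the squared chordal distance. It is rational in the coordinates of the plane and defines
    the same neighbourhoods as the spherical metric. *)
Definition dot_defect p q := 1 - dot3 (stereo p) (stereo q).

Lemma dot_defect_ball e : 0 < e -> exists2 d : R, 0 < d &
  forall p q, dot_defect p q < d -> ball p e q.
Proof.
(* The distance is half the angle, so the angle must stay below 2 e; the cap at pi keeps [a] where
   cos is monotone. *)
move=> e0; have pi0 := pi_gt0 R; set a := Num.min (2 * e) pi.
have a0 : 0 < a by rewrite lt_min pi0 mulr_gt0.
have api : a <= pi by rewrite ge_min lexx orbT.
have a2 : a <= 2 * e by rewrite ge_min lexx.
exists (1 - cos a).
  rewrite subr_gt0 -(cos0 R) ltr_cos// in_itv/= ?lexx ?(ltW pi0)//.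
  by rewrite (ltW a0) api.
move=> p q; rewrite /dot_defect ltrD2l ltrN2 => h.
rewrite ballEmdist /= /mdist /= /spherical_dist ltr_pdivrMr//.
rewrite [e * 2]mulrC; apply: lt_le_trans a2.
have b := dot3_bound (dot3_stereo p) (dot3_stereo q).
rewrite -ltr_cos; last 2 first.
- by rewrite in_itv/= acos_ge0// acos_lepi.
- by rewrite in_itv/= (ltW a0) api.
by rewrite acosK// in_itv.
Qed.

Lemma ball_dot_defect d : 0 < d -> exists2 e : R, 0 < e &
  forall p q, ball p e q -> dot_defect p q < d.
Proof.
move=> d0; have pi0 := pi_gt0 R.
have /cvgrPdist_lt /(_ d d0) : cos x @[x --> (0 : R)] --> cos 0.
  exact: continuous_cos.
rewrite cos0 => /nbhs_ballP[a /= a0 ha].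
pose e := Num.min (a / 4) (pi / 4).
have e0 : 0 < e by rewrite lt_min !divr_gt0.
have e1 : e <= a / 4 by rewrite ge_min lexx.
have e2 : e <= pi / 4 by rewrite ge_min lexx orbT.
exists e => // p q; rewrite ballEmdist /= /mdist /= /spherical_dist.
rewrite ltr_pdivrMr// => pq.
have b := dot3_bound (dot3_stereo p) (dot3_stereo q).
have ca : acos (dot3 (stereo p) (stereo q)) < a by lra.
have c0 := acos_ge0 b.
have := ha (acos (dot3 (stereo p) (stereo q))).
rewrite /ball/= sub0r normrN ger0_norm// => /(_ ca).
rewrite acosK ?in_itv//= => h; apply: le_lt_trans h.
by rewrite ler_norm.
Qed.

Lemma nbhs_dot_defectP p (A : set (riemann_sphere R)) : nbhs p A <->
  exists2 d : R, 0 < d & forall q, dot_defect p q < d -> A q.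
Proof.
split=> [/nbhs_ballP[e /= e0 hA]|[d d0 hA]].
  have [d d0 hd] := dot_defect_ball e0; exists d => // q /hd; exact: hA.
have [e e0 he] := ball_dot_defect d0.
by apply/nbhs_ballP; exists e => // q /he; exact: hA.
Qed.

(** For unit vectors the defect is half the sum of three squared coordinate differences. *)
Lemma dot_defect_sup_dist p q :
  dot_defect p q <= 3 / 2 * sup_dist (stereo p) (stereo q) ^+ 2.
Proof.
rewrite /dot_defect; have := dot3_stereo p; have := dot3_stereo q.
case: (stereo p) (stereo q) => [[u1 u2] u3] [[v1 v2] v3].
rewrite /dot3 /sup_dist /=; set m := Num.max _ _ => hv hu.
have sq x y : `|x - y| <= m -> (x - y) ^+ 2 <= m ^+ 2.
  move=> xy; rewrite -(real_normK (num_real (x - y))).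
  by rewrite ler_pXn2r ?nnegrE// (le_trans _ xy).
have m1 : (u1 - v1) ^+ 2 <= m ^+ 2 by apply: sq; rewrite /m !le_max lexx.
have m2 : (u2 - v2) ^+ 2 <= m ^+ 2 by apply: sq; rewrite /m !le_max lexx !orbT.
have m3 : (u3 - v3) ^+ 2 <= m ^+ 2 by apply: sq; rewrite /m !le_max lexx !orbT.
clear -hu hv m1 m2 m3; lra.
Qed.

Lemma sup_dist_ball e : 0 < e -> exists2 d : R, 0 < d &
  forall p q, sup_dist (stereo p) (stereo q) < d -> ball p e q.
Proof.
move=> /dot_defect_ball[d d0 hd]; exists (Num.min 1 (d / 2)).
  by rewrite lt_min ltr01 divr_gt0.
move=> p q; rewrite lt_min => /andP[s1 s2]; apply: hd.
apply: le_lt_trans (dot_defect_sup_dist _ _) _.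
have : 0 <= sup_dist (stereo p) (stereo q) by rewrite /sup_dist !le_max normr_ge0.
move: s1 s2; move: (sup_dist _ _) => s; nra.
Qed.

Lemma stereo_surj (u : R * R * R) : dot3 u u = 1 -> exists p, stereo p = u.
Proof.
case: u => [[a b] c]; rewrite /dot3 /= => h.
have [c1|c1] := eqVneq c 1.
  have /eqP : a ^+ 2 + b ^+ 2 = 0 by subst c; lra.
  rewrite paddr_eq0 ?sqr_ge0// !sqrf_eq0 => /andP[/eqP-> /eqP->].
  by exists None; rewrite c1.
have c0 : 1 - c != 0 by rewrite subr_eq0 eq_sym.
have D : 1 + (a / (1 - c)) ^+ 2 + (b / (1 - c)) ^+ 2 = 2 / (1 - c).
  have -> : 1 + (a / (1 - c)) ^+ 2 + (b / (1 - c)) ^+ 2 =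
    ((1 - c) ^+ 2 + (a * a + b * b)) / (1 - c) ^+ 2 by field.
  have -> : a * a + b * b = 1 - c * c by lra.
  by field.
exists (Some (a / (1 - c) +i* (b / (1 - c)))%C) => /=.
have D' : (a / (1 - c)) ^+ 2 + (b / (1 - c)) ^+ 2 = 2 / (1 - c) - 1 by lra.
by rewrite D D'; congr (_, _, _); field.
Qed.

(** Compactness is pulled back along [stereo]: the image filter clusters at a point of the unit
    sphere, this point is some [stereo p], and [sup_dist_ball] makes closeness in R^3 closeness to
    p. *)
Lemma compact_riemann_sphere : compact [set: riemann_sphere R].
Proof.
pose S := [set u : R * R * R | dot3 u u = 1].
have cd : continuous (fun u : R * R * R => dot3 u u).
  move=> u; rewrite /dot3.
  have c1 : (fun u : R * R * R => u.1.1) @ u --> u.1.1 by apply: cvg_comp; exact: cvg_fst.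
  have c2 : (fun u : R * R * R => u.1.2) @ u --> u.1.2 by apply: cvg_comp;
    [exact: cvg_fst|exact: cvg_snd].
  have c3 : (fun u : R * R * R => u.2) @ u --> u.2 by exact: cvg_snd.
  by apply: cvgD; [apply: cvgD|]; apply: cvgM.
have cS : compact S.
  pose I := (`[-1, 1]%classic : set R).
  have cI0 : compact I by exact: segment_compact.
  have cI := compact_setX (compact_setX cI0 cI0) cI0.
  have clS : closed S := (continuous_closedP _).1 cd _ (@closed_eq _ (1 : R)).
  apply: (subclosed_compact clS cI).
  move=> [[a b] c]; rewrite /S /I /dot3 /= !in_itv/= => h.
  by split; [split|]; nra.
move=> F FF _.
have [|u [Su cu]] := cS (stereo @ F) _.
  rewrite /= /nbhs /=; apply: filterS filterT => p _; exact: dot3_stereo.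
have [p pu] := stereo_surj Su.
exists p; split=> // A B FA /nbhs_ballP[e /= e0 hB].
have [d d0 hd] := sup_dist_ball e0.
have FA' : (stereo @ F) (stereo @` A).
  by rewrite /= /nbhs /=; apply: filterS FA => q Aq; exists q.
have Nu : nbhs u [set v | sup_dist u v < d].
  exists ([set x | `|u.1.1 - x.1| < d /\ `|u.1.2 - x.2| < d],
          [set x | `|u.2 - x| < d]) => /=; last first.
    by move=> [[a b] c] /= [[h1 h2] h3]; rewrite /sup_dist /= !gt_max h1 h2 h3.
  split; last exact: (nbhsx_ballx u.2 _ d0).
  exists ([set x | `|u.1.1 - x| < d], [set x | `|u.1.2 - x| < d]) => //=.
  by split; [exact: (nbhsx_ballx u.1.1 _ d0)|exact: (nbhsx_ballx u.1.2 _ d0)].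
have [v [[q Aq qv] uv]] := cu _ _ FA' Nu.
by exists q; split=> //; apply: hB; apply: hd; rewrite pu qv.
Qed.

Lemma dot_defect_Some z w : dot_defect (Some z) (Some w) =
  2 * modulus (z - w) ^+ 2 / ((1 + modulus z ^+ 2) * (1 + modulus w ^+ 2)).
Proof.
rewrite !sqr_modulus; case: z w => [a b] [c d]; rewrite /dot_defect /dot3 /=.
have h1 := lt0r_neq0 (stereo_den_gt0 a b); have h2 := lt0r_neq0 (stereo_den_gt0 c d).
rewrite !addrA; field; rewrite ?h1 ?h2//.
Qed.

Lemma dot_defect_None z : dot_defect None (Some z) = 2 / (1 + modulus z ^+ 2).
Proof.
rewrite !sqr_modulus; case: z => [a b]; rewrite /dot_defect /dot3 /=.
have h1 := lt0r_neq0 (stereo_den_gt0 a b); rewrite !addrA; field; rewrite ?h1//.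
Qed.

Let den_ge1 z : 1 <= 1 + modulus z ^+ 2.
Proof. by rewrite lerDl sqr_ge0. Qed.

Lemma nbhs_Some w (A : set (riemann_sphere R)) : nbhs (Some w : riemann_sphere R) A ->
  \forall z \near w, A (Some z).
Proof.
move=> /nbhs_dot_defectP[d d0 hA]; apply/nbhs_modulusP.
exists (Num.min 1 (d / 2)); first by rewrite lt_min ltr01 divr_gt0.
move=> z; rewrite lt_min => /andP[z1 z2]; apply: hA.
rewrite dot_defect_Some modulusB.
have := den_ge1 w; have := den_ge1 z; have := modulus_ge0 (z - w).
move: z1 z2; move: (modulus (z - w)) (1 + modulus z ^+ 2) (1 + modulus w ^+ 2).
move=> m Z W m1 md m0 Z1 W1.
have ZW : 1 <= W * Z by nra.
rewrite ltr_pdivrMr; nra.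
Qed.

Lemma near_Some w e : 0 < e ->
  nbhs (Some w : riemann_sphere R) [set p | exists2 z, p = Some z & modulus (z - w) < e].
Proof.
move=> e0; have N1 := den_ge1 w; set N := 1 + modulus w ^+ 2 in N1 *.
have N0 : 0 < N by lra.
(* The first bound excludes infinity, whose defect is 2 / N, and forces 1 + |z|^2 <= 4 N. The second
   one then gives |z - w| < e. *)
apply/nbhs_dot_defectP; exists (Num.min (1 / (2 * N)) (e ^+ 2 / (2 * N ^+ 2))).
  by rewrite lt_min !divr_gt0// ?mulr_gt0 ?exprn_gt0.
move=> [z|]; last first.
  have -> : dot_defect (Some w) None = dot_defect None (Some w) by rewrite /dot_defect dot3C.
  rewrite dot_defect_None -/N lt_min => /andP[h _]; exfalso.
  by move: h; rewrite ltr_pdivrMr// div1r invfM mulfVK ?gt_eqF//; lra.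
rewrite lt_min dot_defect_Some -/N modulusB => /andP[h1 h2].
exists z => //; rewrite -(ltr_pXn2r (_ : 0 < 2)%N) ?nnegrE ?modulus_ge0 ?(ltW e0)//.
have Zle : 1 + modulus z ^+ 2 <= 2 * N + 2 * modulus (z - w) ^+ 2.
  have := modulusD (z - w) w; rewrite subrK /N.
  have := modulus_ge0 z; have := modulus_ge0 w; have := modulus_ge0 (z - w).
  move: (modulus z) (modulus w) (modulus (z - w)) => a b c c0 b0 a0 abc.
  have : a ^+ 2 <= (c + b) ^+ 2 by rewrite ler_pXn2r ?nnegrE// addr_ge0.
  by have := sqr_ge0 (b - c); clear; lra.
have Z1 := den_ge1 z.
move: h1 h2 Zle Z1; move: (1 + _) (modulus (z - w) ^+ 2) => Z m h1 h2 Zle Z1.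
have Z0 : 0 < Z by lra.
have ZN0 : 0 < N * Z by rewrite mulr_gt0.
move: h1 h2; rewrite !ltr_pdivrMr//.
have -> : 1 / (2 * N) * (N * Z) = Z / 2 by field; rewrite gt_eqF.
have -> : e ^+ 2 / (2 * N ^+ 2) * (N * Z) = e ^+ 2 / 4 * (2 * Z / N).
  by field; rewrite gt_eqF.
move=> h1 h2; have ZN : 2 * Z / N <= 8 by rewrite ler_pdivrMr//; lra.
have e2 : 0 < e ^+ 2 / 4 by rewrite divr_gt0// exprn_gt0.
have := ler_wpM2l (ltW e2) ZN; lra.
Qed.

Lemma nbhs_None (A : set (riemann_sphere R)) : nbhs (None : riemann_sphere R) A ->
  exists M : R, forall z, M < modulus z -> A (Some z).
Proof.
move=> /nbhs_dot_defectP[d d0 hA]; exists (Num.max 1 (2 / d)) => z.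
rewrite gt_max => /andP[z1 z2]; apply: hA; rewrite dot_defect_None.
by move: z2; rewrite !ltr_pdivrMr//; nra.
Qed.

Lemma near_None M :
  nbhs (None : riemann_sphere R) [set p | p = None \/ exists2 z, p = Some z & M < modulus z].
Proof.
have M1 : 0 < 1 + M ^+ 2 by rewrite ltr_pwDl// sqr_ge0.
apply/nbhs_dot_defectP; exists (2 / (1 + M ^+ 2)); first by rewrite divr_gt0.
move=> [z|]; last by left.
rewrite dot_defect_None => h; right; exists z => //.
move: h; rewrite ltr_pM2l// ltf_pV2 ?posrE//; last by have := den_ge1 z; lra.
have := modulus_ge0 z; nra.
Qed.

End SphereTopology.

(** * The boundary of the image *)

Section ConformalBoundary.
Context {R : realType}.
Implicit Types (z w u v : R[i]) (r s t : R) (p : riemann_sphere R).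

Lemma circle_polar z : exists2 t : R, 0 <= t <= 2 * pi & z = circle (modulus z) t.
Proof.
have [->|z0] := eqVneq z 0.
  exists 0; first by rewrite lexx mulr_ge0// pi_ge0.
  by rewrite modulus0 /circle !mul0r.
have m0 : 0 < modulus z by rewrite modulus_gt0.
have sq := sqr_modulus z; move: m0 sq; set m := modulus z; move: m.
case: z z0 => [x y] _ /= m m0 sq.
have xm : -1 <= x / m <= 1.
  rewrite ler_pdivlMr// ler_pdivrMr// mul1r mulN1r -ler_norml.
  rewrite -(ler_pXn2r (_ : 0 < 2)%N) ?nnegrE ?(ltW m0)//.
  by rewrite real_normK ?num_real// sq lerDl sqr_ge0.
have sn : m * sin (acos (x / m)) = `|y|.
  rewrite sin_acos// -{1}[m]ger0_norm ?(ltW m0)// -sqrtr_sqr -sqrtrM ?sqr_ge0//.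
  have -> : m ^+ 2 * (1 - (x / m) ^+ 2) = m ^+ 2 - x ^+ 2 by field; rewrite gt_eqF.
  by rewrite sq addrAC subrr add0r sqrtr_sqr.
have cs : m * cos (acos (x / m)) = x.
  by rewrite acosK ?in_itv//= mulrC divfK// gt_eqF.
have a0 := acos_ge0 xm; have api := acos_lepi xm; have pi0 := pi_ge0 R.
have [y0|y0] := leP 0 y.
  exists (acos (x / m)); first by apply/andP; split=> //; lra.
  by rewrite /circle cs sn ger0_norm.
exists (2 * pi - acos (x / m)); first by apply/andP; split; lra.
rewrite /circle mulr_natl -[_ - _]opprB sinN cosN sinB cosB cos2pi sin2pi.
by rewrite !mulr0 !mulr1 subr0 addr0 mulrN sn ltr0_norm// opprK cs.
Qed.

Lemma compact_closed_disk r : compact [set z : R[i] | modulus z <= r].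
Proof.
pose c (u : R * R) : R[i] := circle u.1 u.2.
have cc : continuous c.
  have cvg_coord (g : R -> R) : continuous g ->
      continuous (fun u : R * R => u.1 * g u.2).
    move=> cg u; apply: cvgM; first exact: cvg_fst.
    by apply: (cvg_comp _ _ (@cvg_snd _ _ _ _ _)); exact: cg.
  move=> u A /nbhs_modulusP[e e0 hA]; have e2 : 0 < e / 2 by rewrite divr_gt0.
  have /cvgrPdist_lt/(_ _ e2) h1 := cvg_coord _ (@continuous_cos R) u.
  have /cvgrPdist_lt/(_ _ e2) h2 := cvg_coord _ (@continuous_sin R) u.
  have N : \forall v \near u, modulus (c v - c u) < e.
    near=> v; apply: le_lt_trans (modulus_le_ReIm _) _; rewrite /c /=.
    rewrite distrC [X in _ + X]distrC [e]splitr; apply: ltrD; by near: v.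
  by rewrite /nbhs/=; apply: filterS N => v; exact: hA.
have cI (a : R) : compact (`[0, a]%classic : set R) by exact: segment_compact.
have -> : [set z | modulus z <= r] = c @` (`[0, r]%classic `*` `[0, 2 * pi]%classic).
  apply/seteqP; split=> [z /= zr|_ [[s t] [/= + _] <-]].
    have [t ht zt] := circle_polar z; exists (modulus z, t) => //=.
    by rewrite !in_itv/= modulus_ge0.
  by rewrite in_itv/= => /andP[s0 sr]; rewrite /c modulus_circle.
apply: continuous_compact; first exact: continuous_subspaceT.
exact: (compact_setX (cI r) (cI _)).
Unshelve. all: by end_near. Qed.

Section Map.
Variable f : R[i] -> R[i].
Hypothesis df : holomorphic (disk 1) f.
Hypothesis fI : {in disk 1 &, injective f}.

Let fcont z : modulus z < 1 -> {for z, continuous f}.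
Proof.
move=> /df/derivable_ccont cf A /nbhs_modulusP[e e0 hA]; apply/nbhs_modulusP.
by have [d d0 hd] := cf e e0; exists d => // w /hd; exact: hA.
Qed.

Lemma open_image_disk r : r <= 1 -> open (f @` disk r).
Proof.
move=> r1; rewrite openE => _ [z zr <-]; rewrite /disk/= in zr.
rewrite /interior /=; pose d := r - modulus z.
have d0 : 0 < d by rewrite subr_gt0.
have d2 : 0 < d / 2 by rewrite divr_gt0.
have d1 : d / 2 < d by lra.
have sub w : modulus (w - z) < d -> modulus w < r.
  have := modulusD (w - z) z; rewrite subrK /d; lra.
have h := @open_mapping_at R f z d (d / 2) d2 d1.
have {}h : \forall w \near f z, exists2 x, modulus (x - z) < d & f x = w.
  apply: h => [w /sub wr|t]; first by apply: df; apply: lt_le_trans r1.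
  apply/eqP => /fI; rewrite !inE /disk/= => E.
  have : z + circle (d / 2) t = z.
    apply: E; last exact: lt_le_trans r1.
    apply: lt_le_trans r1; apply: sub.
    by rewrite addrAC subrr add0r modulus_circle// ltW.
  rewrite -[RHS]addr0 => /addrI/eqP; rewrite -modulus_eq0 modulus_circle ?ltW//.
  by rewrite gt_eqF.
by apply: filterS h => w [x /sub xr <-]; exists x.
Qed.

Lemma compact_image_closed_disk r : r < 1 ->
  compact (f @` [set z | modulus z <= r]).
Proof.
move=> r1; apply: continuous_compact (@compact_closed_disk r).
apply: continuous_in_subspaceT => z; rewrite inE /= => zr.
exact/fcont/(le_lt_trans zr).
Qed.

(** If the segment missed the image of the circle, the open image of the disk and the compact image
    of the closed disk would have the same preimage in [0, b]. This preimage would be open, closed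
    and nonempty, hence everything. Direction [v] and length [b] are separate to cover segments and
    rays alike. *)
Lemma segment_meets_circle_image r u v (b : R) : 0 < r < 1 -> 0 <= b ->
  (f @` disk r) u -> ~ (f @` disk r) (u + (b%:C)%C * v) ->
  exists2 t : R, 0 <= t <= b &
    exists2 s : R, 0 <= s <= 2 * pi & f (circle r s) = u + (t%:C)%C * v.
Proof.
move=> /andP[r0 r1] b0 fu fv; apply: contrapT => nex.
pose phi (t : R) : R[i] := u + (t%:C)%C * v.
have cphi : continuous phi.
  move=> t A /nbhs_modulusP[e e0 hA]; have v0 := modulus_ge0 v.
  have k0 : 0 < e / (modulus v + 1) by rewrite divr_gt0// ltr_wpDl.
  apply/nbhs_ballP; exists (e / (modulus v + 1)) => // s; rewrite /ball/= distrC => st.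
  apply: hA; rewrite /phi opprD addrACA subrr add0r -mulrBl -rmorphB/= modulusM modulus_real.
  by move: st; rewrite ltr_pdivlMr ?ltr_wpDl//; have := normr_ge0 (s - t); lra.
have I0 : `[0, b]%classic 0 by rewrite /= in_itv/= lexx.
have Ib : `[0, b]%classic b by rewrite /= in_itv/= b0 lexx.
have E : `[0, b] `&` phi @^-1` (f @` disk r) =
    `[0, b] `&` phi @^-1` (f @` [set z | modulus z <= r]).
  apply/seteqP; split=> t [It [z zr zt]]; split=> //; exists z => //.
    exact: ltW.
  rewrite /disk/= lt_neqAle; apply/andP; split=> //; apply/eqP => zr'.
  apply: nex; exists t; first by move: It; rewrite /= in_itv.
  have [s hs zs] := circle_polar z; exists s => //.
  by rewrite -zr' -zs.
suff conn : `[0, b] `&` phi @^-1` (f @` disk r) = `[0, b]%classic.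
  by move: Ib; rewrite -conn => -[_]; exact: fv.
apply: segment_connected.
- by exists 0; split=> //=; rewrite /phi mul0r addr0.
- exists (phi @^-1` (f @` disk r)) => //.
  by move/continuousP : cphi; apply; apply: open_image_disk; exact: ltW.
rewrite E; exists (phi @^-1` (f @` [set z | modulus z <= r])) => //.
move/continuous_closedP : cphi; apply.
by apply: compact_closed; [exact: norm_hausdorff|exact: compact_image_closed_disk].
Qed.

Let Omega := @to_sphere R @` (f @` disk 1).

Lemma boundary_near_circle_image p (W : set (riemann_sphere R)) :
  boundary Omega p -> nbhs p W ->
  exists2 r0 : R, r0 < 1 & forall r, r0 < r -> r < 1 ->
    exists2 s : R, 0 <= s <= 2 * pi & W (Some (f (circle r s))).
Proof.
(* The end [b] may depend on r: towards infinity, the ray must be followed until it leaves the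
   bounded set f(D_r). *)
have key z v : modulus z < 1 ->
    (forall r, r < 1 -> exists b : R, [/\ 0 <= b,
      ~ (f @` disk r) (f z + (b%:C)%C * v) &
      forall t : R, 0 <= t <= b -> W (Some (f z + (t%:C)%C * v))]) ->
    exists2 r0 : R, r0 < 1 & forall r, r0 < r -> r < 1 ->
    exists2 s : R, 0 <= s <= 2 * pi & W (Some (f (circle r s))).
  move=> z1 H; exists (modulus z) => // r zr r1.
  have [b [b0 nb hW]] := H r r1.
  have r_gt0 : 0 < r < 1 by rewrite r1 andbT (le_lt_trans _ zr)// modulus_ge0.
  have fz : (f @` disk r) (f z) by exists z.
  have [t tb [s sp fs]] := segment_meets_circle_image r_gt0 b0 fz nb.
  by exists s => //; rewrite fs; exact: hW.
move=> [cp ip] pW; case: p cp ip pW => [w|] cp ip pW.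
  have nw : ~ (f @` disk 1) w.
    move=> fw; apply: ip.
    have : \forall v \near w, (f @` disk 1) v.
      by apply: open_nbhs_nbhs; split=> //; apply: open_image_disk.
    move=> /nbhs_modulusP[e e0 he]; apply: filterS (near_Some w e0).
    by move=> _ [v -> /he fv]; exists v.
  have /nbhs_modulusP[e e0 he] := nbhs_Some pW.
  have [_ [[_ [z z1 <-] <-]] [u [uz] uw]] := cp _ (near_Some w e0).
  case: uz uw => <- {u} uw.
  apply: (key z (w - f z)) => // r r1; exists 1; split=> //.
    by rewrite mul1r addrC subrK => -[x xr xw]; apply: nw; exists x => //;
      apply: lt_trans xr r1.
  move=> t /andP[t0 t1]; apply: he.
  have -> : f z + (t%:C)%C * (w - f z) - w = ((1 - t)%:C)%C * (f z - w).
    by rewrite rmorphB rmorph1; ring.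
  rewrite modulusM modulus_real ger0_norm ?subr_ge0//.
  by apply: le_lt_trans uw; rewrite ler_piMl ?modulus_ge0// lerBlDr lerDl.
have [M hM] := nbhs_None pW.
(* The maximum with 0 makes f z nonzero, so that the ray through it goes to infinity. *)
have [_ [[_ [z z1 <-] <-]] [//|[u [<-]]]] := cp _ (near_None (Num.max M 0)).
rewrite gt_max => /andP[Mz z0]; apply: (key z (f z)) => // r r1.
have [B hB] : exists B : R, forall x, modulus x <= r -> modulus (f x) <= B.
  have [r0|r0] := ltP r 0.
    by exists 0 => x; rewrite leNgt (lt_le_trans r0)// modulus_ge0.
  have [||x _ hx] := compact_EVT_max _ (@compact_closed_disk r) (f := fun x => modulus (f x)).
  - by exists 0; rewrite /= modulus0.
  - apply: continuous_in_subspaceT => x; rewrite inE /= => xr.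
    move=> A /nbhs_ballP[e /= e0 hA]; apply/nbhs_modulusP.
    have [d d0 hd] := derivable_ccont (df (le_lt_trans xr r1)) e0.
    exists d => // y /hd yx; apply: hA; rewrite /ball/=.
    apply: le_lt_trans yx; rewrite ler_norml.
    have := modulusD (f y - f x) (f x); have := modulusD (f x - f y) (f y).
    by rewrite !subrK (modulusB (f x) (f y)); lra.
  by exists (modulus (f x)) => y yr; apply: hx; rewrite inE.
(* At this parameter the ray has modulus |f z| + |B|, more than the bound B on the disk. *)
exists (`|B| / modulus (f z)); split; first by rewrite divr_ge0// ltW.
  move=> [x /ltW/hB xB fx]; move: xB; rewrite fx -{1}[f z]mul1r -mulrDl modulusM.
  rewrite -(rmorph1 (real_complex R)) -rmorphD modulus_real ger0_norm; last first.
    by rewrite addr_ge0// divr_ge0// ltW.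
  rewrite mulrDl mul1r divfK ?gt_eqF//.
  by have := ler_norm B; lra.
move=> t /andP[t0 _]; apply: hM; apply: lt_le_trans Mz _.
rewrite -{2}[f z]mul1r -mulrDl modulusM -(rmorph1 (real_complex R)) -rmorphD modulus_real.
by rewrite ler_peMl ?(ltW z0)// ger0_norm ?lerDl// addr_ge0.
Qed.

(** An interior point p would be some f z. For |z| < r < 1 the set f(D_r) is a neighbourhood of it,
    and by injectivity it contains no f x with r < |x| < 1. *)
Lemma boundary_cluster p :
  (forall W r0, nbhs p W -> r0 < 1 -> exists z,
     [/\ r0 < modulus z, modulus z < 1 & W (Some (f z))]) -> boundary Omega p.
Proof.
move=> H; split=> [W pW|].
  have [z [_ z1 Wz]] := H W 0 pW ltr01.
  by exists (Some (f z)); split=> //; exists (f z) => //; exists z.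
move=> ip; have [_ [z z1 <-] fzp] := interior_subset ip.
have r1 : (modulus z + 1) / 2 < 1 by rewrite /disk/= in z1; lra.
have zr : modulus z < (modulus z + 1) / 2 by rewrite /disk/= in z1; lra.
move: r1 zr; set r := _ / 2 => r1 zr.
have : \forall v \near f z, (f @` disk r) v.
  apply: open_nbhs_nbhs; split; first by apply: open_image_disk; exact: ltW.
  by exists z.
move=> /nbhs_modulusP[e e0 he].
have pW := near_Some (f z) e0; rewrite -/(to_sphere _) fzp in pW.
have [x [rx x1 [_ [<-] /he [y yr yx]]]] := H _ r pW r1.
have xy : x = y.
  by apply: fI; rewrite ?inE//; apply: lt_trans yr r1.
by move: yr; rewrite -xy /disk/= ltNge (ltW rx).
Qed.

End Map.
End ConformalBoundary.

(** * Limits of paths *)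

(** A path from a segment to a Hausdorff space is a quotient map onto its image, and quotients
    inherit local connectedness. Concretely, the preimage of the component [C] is open in [a, b], so
    [K] minus [C] is the image of a compact set and hence closed. *)
Lemma path_image_locally_connected (R : realType) (T : topologicalType)
    (g : R -> T) (a b : R) : hausdorff_space T -> continuous g ->
  locally_connected (g @` `[a, b]).
Proof.
move=> hT cg x U Kx oU Ux; set K := g @` _ in Kx *.
pose C := connected_component (U `&` K) x.
have CU : C `<=` U `&` K by exact: connected_component_sub.
have Cx : C x by apply: connected_component_refl.
(* Near s, the interval between s and t is mapped into U, and its image is a connected set that
   joins g s to g t. *)
have loc s : s \in `[a, b] -> C (g s) ->
    \forall t \near s, t \in `[a, b] -> C (g t).
  move=> sab Cs; have [Us _] := CU _ Cs.
  have /nbhs_ballP[e /= e0 he] : nbhs s (g @^-1` U).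
    by apply: cg; apply: open_nbhs_nbhs.
  apply/nbhs_ballP; exists e => // t st tab.
  pose I := `[Num.min s t, Num.max s t]%classic : set R.
  have Is : I s by rewrite /I /= in_itv/= ge_min le_max lexx.
  have It : I t by rewrite /I /= in_itv/= ge_min le_max lexx !orbT.
  apply: (connected_component_trans Cs).
  exists (g @` I); last by exists t.
  split; first by exists s.
    move=> _ [u Iu <-].
    have su : ball s e u.
      move: st Iu; rewrite /I /ball/= in_itv/= ge_min le_max !ltr_norml; clear.
      by move=> ? /andP[/orP[] ? /orP[] ?]; lra.
    split; first exact: he.
    exists u => //; move: sab tab Iu; rewrite /I /= !in_itv/= ge_min le_max; clear.
    by move=> ? ? /andP[/orP[] ? /orP[] ?]; lra.
  apply: connected_continuous_connected; first exact: segment_connected.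
  exact: continuous_subspaceT.
have cKC : closed (K `\` C).
  apply: (compact_closed hT).
  have -> : K `\` C = g @` (`[a, b]%classic `&` g @^-1` (~` C)).
    apply/seteqP; split=> [_ [[s sab <-] nC]|_ [s [sab nC] <-]]; first by exists s.
    by split=> //; exists s.
  apply: continuous_compact; first exact: continuous_subspaceT.
  apply: (subclosed_compact _ (@segment_compact R a b)); last exact: subIsetl.
  move=> s hs; have sab : `[a, b]%classic s.
    have cI : closed `[a, b]%classic by exact: interval_closed.
    by apply: cI; apply: closureS hs; exact: subIsetl.
  split=> // Cs; have [t [[tab nC] ht]] := hs _ (loc s sab Cs).
  exact/nC/ht.
exists (~` (K `\` C)).
have VK : ~` (K `\` C) `&` K = C.
  apply/seteqP; split=> [y [nKC Ky]|y Cy].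
    by apply: contrapT => nC; apply: nKC.
  by split; [case|have [] := CU _ Cy].
split; first exact: closed_openC.
- by case.
- by rewrite VK => y /CU[].
by rewrite VK; exact: component_connected.
Qed.

Lemma ultra_fmap (S T : Type) (g : S -> T) (F : set_system S) :
  UltraFilter F -> UltraFilter (g @ F).
Proof.
move=> FU; split=> [|H HP FH]; first exact: fmap_proper_filter.
apply/seteqP; split=> [A HA|]; last exact: FH.
have [//|nA] := in_ultra_setVsetC (g @^-1` A) FU.
have HnA : H (~` A) by exact: FH.
by have /filter_ex[x []] : H (A `&` ~` A) by exact: filterI.
Qed.

Section UltraLimit.
Context {R : realType}.
Local Notation sphere := (riemann_sphere R).

(* Arzela-Ascoli, with an ultrafilter in place of a convergent subsequence. *)
Lemma ultralimit_path (G : set_system R) (P : set R) (g : R -> R -> sphere) (L : R)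
    (K : set sphere) : UltraFilter G -> G P ->
  (forall r s t, P r -> sup_dist (stereo (g r t)) (stereo (g r s)) <= `|t - s|) ->
  (forall s (p : sphere), (forall W, nbhs p W -> \forall r \near G, W (g r s)) -> K p) ->
  (forall p W, K p -> nbhs p W -> \forall r \near G, exists2 s, 0 <= s <= L & W (g r s)) ->
  exists2 h : R -> sphere, continuous h & K = h @` `[0, L].
Proof.
move=> GU GP lip sub sup.
have lim (F : set_system sphere) : UltraFilter F -> exists p : sphere, nbhs p `<=` F.
  move=> FU; have := @compact_riemann_sphere R; rewrite compact_ultra.
  by move=> /(_ F FU filterT)[p [_ Fp]]; exists p.
have /choice[h Hh] s : exists p : sphere, nbhs p `<=` (g ^~ s @ G) by apply: lim; exact: ultra_fmap.
have equi (e : R) : 0 < e -> exists2 d : R, 0 < d & forall s t, `|t - s| < d ->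
    forall r, P r -> ball (g r t) e (g r s).
  move=> /sup_dist_ball[d d0 hd]; exists d => // s t st r Pr; apply: hd.
  exact: le_lt_trans (lip _ _ _ Pr) _.
(* The tolerance doubles because h s is only approximated by the points g r s. *)
have cls (e : R) p s : 0 < e -> (\forall r \near G, ball p e (g r s)) -> ball p (e + e) (h s).
  move=> e0 Hp; have Gh := Hh s _ (nbhsx_ballx (h s) e e0).
  have /filter_ex[r [/= h1 h2]] : G ([set r | ball p e (g r s)] `&`
      [set r | ball (h s) e (g r s)]) by apply: filterI.
  by apply: ball_triangle h1 (ball_sym h2).
have ch : continuous h.
  move=> s A /nbhs_ballP[e /= e0 hA]; have e4 : 0 < e / 4 by rewrite divr_gt0.
  have [d d0 hd] := equi _ e4; apply/nbhs_ballP; exists d => // t st; apply: hA.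
  have -> : e = (e / 4 + e / 4) + (e / 4 + e / 4) by lra.
  apply: cls; first by rewrite addr_gt0.
  have Gh := Hh s _ (nbhsx_ballx (h s) _ e4).
  apply: (@filterS2 _ G _ _ _ _ _ GP Gh) => r Pr /= hr.
  by apply: ball_triangle hr _; apply: hd => //; rewrite distrC.
exists h => //; apply/seteqP; split=> [p Kp|_ [s _ <-]]; last first.
  by apply: (sub s) => W hW; exact: (Hh s W hW).
have : closure (h @` `[0, L]) p.
  move=> W /nbhs_ballP[e /= e0 hW]; have e4 : 0 < e / 4 by rewrite divr_gt0.
  have H := sup p _ Kp (nbhsx_ballx p _ e4).
  (* The parameter near p varies with r; its limit [s0] along the ultrafilter exists in [0, L], and
     equicontinuity lets [s0] replace it. The value 0 is a default for the other r. *)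
  have /choice[s Hs] r : exists s, (exists2 t, 0 <= t <= L & ball p (e / 4) (g r t)) ->
      0 <= s <= L /\ ball p (e / 4) (g r s).
    have [[t tL pt]|nt] := pselect (exists2 t, 0 <= t <= L & ball p (e / 4) (g r t)).
      by exists t.
    by exists 0.
  have {}H : \forall r \near G, 0 <= s r <= L /\ ball p (e / 4) (g r (s r)).
    by apply: filterS H => r; exact: Hs.
  have [s0 [s0L Gs0]] : exists s0, s0 \in `[0, L] /\ (s @ G) --> s0.
    have := @segment_compact R 0 L; rewrite compact_ultra => /(_ (s @ G) (ultra_fmap _ GU)) [].
      by apply: filterS H => r [sr _]; rewrite /= in_itv.
    by move=> s0 [s0L cs0]; exists s0.
  exists (h s0); split; first by exists s0.
  apply: hW; have [d d0 hd] := equi _ e4.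
  have -> : e = (e / 4 + e / 4) + (e / 4 + e / 4) by lra.
  apply: cls; first by rewrite addr_gt0.
  have Hd := Gs0 _ (nbhsx_ballx s0 _ d0).
  apply: (@filterS3 _ G _ _ _ _ _ _ GP H Hd) => r Pr [_ pr] /= sr.
  by apply: ball_triangle pr _; apply: hd => //; rewrite distrC.
have cK : closed (h @` `[0, L]).
  apply: compact_closed; first exact: metric_hausdorff.
  by apply: continuous_compact; [exact: continuous_subspaceT|exact: segment_compact].
exact: cK.
Qed.

End UltraLimit.

Lemma circle_integral_bound (R : realType) (f : R[i] -> R[i]) r :
  holomorphic (disk 1) f -> (Lambda_sph f < +oo)%E -> 0 < r < 1 ->
  seg_int 0 (2 * pi) (fun t => 2 * (spherical_derivative f (circle r t) * r)) <=
  2 * fine (Lambda_sph f).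
Proof.
move=> df Lf r01.
have sd0 t : 0 <= spherical_derivative f (circle r t) * r.
  rewrite !mulr_ge0 ?modulus_ge0 ?invr_ge0 ?addr_ge0 ?sqr_ge0//.
  by case/andP: r01 => /ltW.
have CI : (circle_integral r (spherical_derivative f) <= Lambda_sph f)%E.
  by apply: ereal_sup_ubound; exists r => //; rewrite /= in_itv.
have CI0 : (0 <= circle_integral r (spherical_derivative f))%E.
  by apply: integral_ge0 => t _; rewrite lee_fin.
have -> : seg_int 0 (2 * pi) (fun t => 2 * (spherical_derivative f (circle r t) * r)) =
    2 * fine (circle_integral r (spherical_derivative f)).
  rewrite /seg_int RintegralZl//; apply: seg_integrable => x _.
  exact: spherical_derivative_circle_continuous.
(* Both sides must be finite here, because [fine] sends infinity to 0. *)
rewrite ler_pM2l// fine_le//.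
  by rewrite ge0_fin_numE// (le_lt_trans CI).
by rewrite ge0_fin_numE// (le_trans CI0).
Qed.

Theorem theoremA3 (R : realType) (f : R[i] -> R[i]) (Omega : set R[i]) :
  conformal_map f Omega ->
  (Lambda_sph f < +oo)%E ->
  locally_connected (boundary (@to_sphere R @` Omega)).
Proof.
move=> [df fI _ <-] Lf; set K := boundary _; set L := 2 * fine (Lambda_sph f).
have /choice[sigma Hs] r : exists sigma : R -> R, 0 < r < 1 ->
    (forall s t, sup_dist (stereo (Some (f (circle r (sigma t)))))
       (stereo (Some (f (circle r (sigma s))))) <= `|t - s|) /\
    (forall t, 0 <= t <= 2 * pi -> exists2 s, 0 <= s <= L &
       f (circle r (sigma s)) = f (circle r t)).
  have [r01|nr] := pselect (0 < r < 1); last by exists id => /nr.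
  by have [s hs] := arclength_parametrization df r01 (circle_integral_bound df Lf r01); exists s.
(* An ultrafilter finer than the left neighbourhoods of 1, along which r tends to 1. *)
have [G [GU sG]] := ultraFilterLemma (at_left_proper_filter (1 : R)).
have left1 (r0 : R) : r0 < 1 -> G [set r | r0 < r < 1].
  by move=> r01; apply: sG; near=> r; rewrite /=; apply/andP; split; near: r;
    [exact: nbhs_left_gt|exact: nbhs_left_lt].
have [||||h ch ->] := @ultralimit_path R G [set r | 0 < r < 1]
    (fun r s => Some (f (circle r (sigma r s)))) L K GU.
- exact: left1.
- by move=> r s t /Hs[+ _]; exact.
- move=> s p hp; apply: (boundary_cluster df fI) => W r0 /hp pW r01.
  (* The threshold may be negative; the maximum with 0 keeps r a genuine radius. *)
  have r01' : Num.max 0 r0 < 1 by rewrite gt_max ltr01.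
  have /filter_ex[r [/= /andP[+ r1] Wr]] : G ([set r | Num.max 0 r0 < r < 1] `&`
      [set r | W (Some (f (circle r (sigma r s))))]) by apply: filterI => //; exact: left1.
  rewrite gt_max => /andP[r_gt0 r0r].
  by exists (circle r (sigma r s)); rewrite modulus_circle ?(ltW r_gt0).
- move=> p W /(boundary_near_circle_image df fI) H /H[r0 r01 hr0].
  have r01' : Num.max 0 r0 < 1 by rewrite gt_max ltr01.
  apply: filterS (left1 _ r01') => r /= /andP[+ r1]; rewrite gt_max => /andP[r_gt0 r0r].
  have [t tp Wt] := hr0 r r0r r1.
  have [|_ /(_ t tp)[s sL fs]] := Hs r; first by rewrite r_gt0.
  by exists s => //; rewrite fs.
apply: path_image_locally_connected => //; exact: metric_hausdorff.
Unshelve. all: by end_near. Qed.
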